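(* Let $d\ge1$ and let $(Y_i)_{i\in\mathbb Z}$ be a strictly stationary sequence of random points, each uniformly distributed on $[0,1]^d$, with strong-mixing coefficients satisfying $\alpha(r)\le\varphi(r)$ for all $r\ge1$, where $\varphi:\mathbb N\to[0,\infty)$ satisfies $\sum_{r=0}^\infty r\,\varphi(r)<\infty$ and, for some $\delta>0$, $\sum_{r=1}^\infty\varphi(r)^{\delta/(2+\delta)}<\infty$. Let $(c_j,p_j)_{j=1}^m$ be a finite collection of corner–point pairs. Then, as $n\to\infty$, $$\frac1{\sqrt n}\sum_{k=0}^{n-1}\Bigl(\mathbf 1\{Y_k\in\mathrm{cornerLe}(c_j,p_j)\}-F^{c_j}(p_j)\Bigr)_{j=1}^m\xrightarrow{\ \mathcal D\ }\mathcal N(0,S),$$ where $S$ is the $m\times m$ matrix $S_{a,b}=\sum_{r\in\mathbb Z}\mathrm{Cov}\bigl(\xi_{c_a,p_a}(Y_0),\,\xi_{c_b,p_b}(Y_r)\bigr)$.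
   Context: A corner of $[0,1]^d$ is a function $c:\{0,\dots,d-1\}\to\{\mathrm{true},\mathrm{false}\}$; a corner–point pair $(c,p)$ consists of a corner $c$ and a point $p\in[0,1]^d$. $\mathrm{cornerLe}(c,p)=\{s\in[0,1]^d:\ \text{for all }k,\ s_k\ge p_k\text{ if }c(k)=\mathrm{true},\ s_k\le p_k\text{ if }c(k)=\mathrm{false}\}$, and $F^c(p)=\prod_{k=0}^{d-1}g_k(p)$ with $g_k(p)=1-p_k$ if $c(k)=\mathrm{true}$ and $g_k(p)=p_k$ otherwise. $\xi_{c,p}(y)=\mathbf 1\{y\in\mathrm{cornerLe}(c,p)\}-F^c(p)$. For $r\ge1$, $\alpha(r)=\sup_{m\in\mathbb Z}\alpha\bigl(\sigma(Y_i:i\le m),\sigma(Y_i:i\ge m+r)\bigr)$, where $\alpha(\mathcal A,\mathcal B)=\sup\{|\mathbb P(A\cap B)-\mathbb P(A)\mathbb P(B)|:A\in\mathcal A,B\in\mathcal B\}$. Gaussian laws may be degenerate; the covariance series defining $S$ converge absolutely under the stated assumptions. *)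

(* Defs.v *)
From HB Require Import structures.
From mathcomp Require Import all_boot all_order all_algebra.
From mathcomp Require Import all_classical all_reals all_analysis.

Set Implicit Arguments.
Unset Strict Implicit.
Unset Printing Implicit Defensive.

Import Order.TTheory GRing.Theory Num.Theory.
Import numFieldNormedType.Exports.

Local Open Scope classical_set_scope.
Local Open Scope ring_scope.

(* Vectors of R^n carried by random variables are tuples, because n.-tuple R
   has the product sigma-algebra (of the Borel sets of R) as its canonical
   measurable structure. *)

Section corners.
Context {R : realType} {d : nat}.
Implicit Types (c : 'I_d -> bool) (p y : d.-tuple R).

Definition unit_cube : set (d.-tuple R) :=
  [set y | forall k, 0 <= tnth y k <= 1].

Definition cornerLe c p : set (d.-tuple R) :=
  [set s | unit_cube s /\
     forall k, if c k then tnth p k <= tnth s k else tnth s k <= tnth p k].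

Definition cornerF c p : R :=
  \prod_(k < d) (if c k then 1 - tnth p k else tnth p k).

Definition xi c p y : R := \1_(cornerLe c p) y - cornerF c p.

End corners.

Section process.
Context {disp : measure_display} {T : measurableType disp} {R : realType}.
Variable P : probability T R.

(* The uniform distribution on [0,1]^d is the d-fold product of the uniform
   distribution on [0,1]; a law on R^d is this product as soon as it agrees
   with it on measurable rectangles. *)
Definition uniform_on_cube {d : nat} (X : {RV P >-> d.-tuple R}) : Prop :=
  forall A : 'I_d -> set R, (forall k, measurable (A k)) ->
    P [set w | forall k, A k (tnth (X w) k)] =
    (\prod_(k < d) uniform_prob (@ltr01 R) (A k))%E.

Definition strictly_stationary {d : nat} (Y : int -> {RV P >-> d.-tuple R}) :
    Prop :=
  forall (k : nat) (i : 'I_k -> int) (h : int)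
         (B : set (k.-tuple (d.-tuple R))), measurable B ->
    P [set w | B [tuple Y (i j + h) w | j < k]] =
    P [set w | B [tuple Y (i j) w | j < k]].

Definition sigma_of {d : nat} (Y : int -> {RV P >-> d.-tuple R})
    (I : set int) : set (set T) :=
  <<s \bigcup_(i in I) g_sigma_algebra_preimage (Y i) >>.

Definition alpha_sets (F G : set (set T)) : \bar R :=
  ereal_sup [set z | exists A B,
    [/\ F A, G B & z = (`|P (A `&` B) - P A * P B|)%E]].

Definition alpha_mixing {d : nat} (Y : int -> {RV P >-> d.-tuple R})
    (r : nat) : \bar R :=
  ereal_sup [set z | exists k : int,
    z = alpha_sets (sigma_of Y [set i | i <= k])
                   (sigma_of Y [set i | k + r%:Z <= i])].

(* Sum of an absolutely summable family indexed by int. *)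
Definition sum_int (a : int -> \bar R) : R :=
  fine (\esum_(r in [set: int]) (a^\+)%E r - \esum_(r in [set: int]) (a^\-)%E r)%E.

Definition cov_lag {d : nat} (Y : int -> {RV P >-> d.-tuple R})
    (f g : d.-tuple R -> R) (r : int) : \bar R :=
  covariance P (f \o Y 0) (g \o Y r).

Definition longrun_cov {d m : nat} (Y : int -> {RV P >-> d.-tuple R})
    (c : 'I_m -> 'I_d -> bool) (p : 'I_m -> d.-tuple R) : 'M[R]_m :=
  \matrix_(a, b) sum_int (cov_lag Y (xi (c a) (p a)) (xi (c b) (p b))).

Definition normalized_sums {d m : nat} (Y : int -> {RV P >-> d.-tuple R})
    (c : 'I_m -> 'I_d -> bool) (p : 'I_m -> d.-tuple R) (n : nat) (w : T) :
    m.-tuple R :=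
  [tuple (Num.sqrt n%:R)^-1 * \sum_(k < n) xi (c j) (p j) (Y k%:Z w) | j < m].

(* The topology of R^m is that of row vectors. *)
Definition row_of_tuple {m : nat} (x : m.-tuple R) : 'rV[R]_m :=
  \row_j tnth x j.

Definition cvg_in_distribution {m : nat} (X : nat -> T -> m.-tuple R)
    (mu : probability (m.-tuple R) R) : Prop :=
  forall g : 'rV[R]_m -> R,
    continuous g -> (exists M : R, forall x, `|g x| <= M) ->
    'E_P[fun w => g (row_of_tuple (X n w))]%E @[n --> \oo] -->
    (\int[mu]_x (g (row_of_tuple x))%:E)%E.

End process.

(* N(0, v) with variance v >= 0; normal_prob takes the standard deviation and
   is not the Dirac mass when the latter is 0. *)
Definition centered_normal {R : realType} (v : R) (B : set R) : \bar R :=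
  if v == 0 then \d_(0 : R) B else normal_prob 0 (Num.sqrt v) B.

(* mu = N(0, S), possibly degenerate: every linear combination of the
   coordinates is a centered normal variable with the variance given by S. *)
Definition gaussian_law {R : realType} {m : nat} (S : 'M[R]_m)
    (mu : probability (m.-tuple R) R) : Prop :=
  S^T = S /\
  forall u : 'rV[R]_m,
    let v := (u *m S *m u^T) 0 0 in
    0 <= v /\
    forall B : set R, measurable B ->
      mu [set x | B (\sum_(j < m) u 0 j * tnth x j)] = centered_normal v B.

(* Main.v *)
(* By Cramer-Wold it would suffice to treat u . S_n for every u; instead of Levy's
   theorem we test convergence directly on the functions cos (a + u . x). These
   determine weak convergence when second moments are bounded: composing a
   Bernstein polynomial with (1 + sin) / 2 in each variable approximates a bounded
   continuous function uniformly on a large box by a trigonometric polynomial with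
   the same bound, and Chebyshev's inequality controls the rest.

   For a fixed u the sums of x_k = u . xi(Y_k) are handled by blocks of length p
   separated by gaps of length q. Cov (f, g) is at most 4 alpha for f and g bounded
   by 1, since f and g are mixtures of indicators of their level sets. As
   sum r phi(r) is finite, a block of length p has variance p v + O(1), and the
   coefficient of a gap q is O(q^-2). Deleting the last block from
   E cos (a + l . sum) therefore costs the factor exp (- l^2 p v / 2), up to a
   mixing error and Taylor remainders. Letting q be of order sqrt n / M^2 and
   p = M q, then n and M tend to infinity, gives the limit cos a exp (- v / 2).

   The law N(0, S) is the image of independent normal variables under A, where
   S = A A^T; it is recognized through the same cosines, E cos (a + s N) solving a
   linear differential equation in s. *)

Require Import Defs.
From HB Require Import structures.
From mathcomp Require Import all_boot all_order all_algebra.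
From mathcomp Require Import all_classical all_reals all_analysis.
From mathcomp Require Import measurable_realfun ring lra.

Set Implicit Arguments.
Unset Strict Implicit.
Unset Printing Implicit Defensive.

Import Order.TTheory GRing.Theory Num.Theory.
Import numFieldNormedType.Exports.

Local Open Scope classical_set_scope.
Local Open Scope ring_scope.

(** The phase [a] in cos (a + u . x) stands in for complex exponentials: real cosines with a phase
    include sines and constants, are closed under products up to linear combinations, and split by
    the addition formula into cosines of the past and of the last block. The weight r in sum r
    phi(r) has a combinatorial origin: the variance of a block of length p is the sum over l < p of
    the long-run variance truncated at lag l, and lag r is missing from at most r of these terms.
    The error is thus bounded uniformly in p. Letting p grow, the same estimate shows v >= 0, that
    is, positivity of S, so that N(0, S) can be constructed even when S is singular. The constant 4
    is 2 * 2: a function with values in [-1, 1] is -1 plus the integral of its level indicators over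
    an interval of length 2. The factor of each block lies in [0, 1], so errors merely add up along
    the blocks. [gaussian_law] describes the laws of linear combinations on all Borel sets; cosines
    must therefore also determine a probability on the line, and the trigonometric approximation
    serves a second time. *)

Section real_lemmas.
Context {R : realType}.

Lemma natr_large (C e : R) : 0 < e ->
  exists2 N, (0 < N)%N & C / N%:R <= e.
Proof.
move=> e0; exists (Num.truncn (C / e)).+1 => //.
rewrite ler_pdivrMr ?ltr0n// mulrC -ler_pdivrMr// ltW//.
exact/real_truncnS_gt/num_real.
Qed.

Lemma is_derive_mul (f g : R -> R) (x a b : R) :
  is_derive x 1 f a -> is_derive x 1 g b ->
  is_derive x 1 (fun y => f y * g y) (a * g x + f x * b).
Proof.
move=> df dg; apply: (@is_derive_eq _ _ _ (f * g)%R _ _ _ _ (is_deriveM df dg)).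
by rewrite /GRing.scale/= addrC [g x * a]mulrC.
Qed.

Lemma is_derive_affine (a b x : R) : is_derive x 1 (fun y => a + b * y) b.
Proof.
have H := is_derive_mul (is_derive_cst b x 1) (is_derive_id x 1).
apply: (@is_derive_eq _ _ _ (cst a + (fun y => b * y)) _ _ _ _ (is_deriveD (is_derive_cst a x 1) H)).
by rewrite /= mul0r !add0r mulr1.
Qed.

End real_lemmas.

(** * Means of bounded functions *)

Section mean.
Context {disp : measure_display} {T : measurableType disp} {R : realType}.
Variable P : probability T R.
Implicit Types f g : T -> R.

(** A class stable under sums, products and powers whose members are integrable for every
    probability: integrability side conditions reduce to these closure properties, and means are
    plain real numbers. *)
Definition bounded_mfun f :=
  measurable_fun setT f /\ exists M, forall x, `|f x| <= M.

Definition mean f : R := \int[P]_x f x.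

Lemma bounded_mfun_le f M :
  measurable_fun setT f -> (forall x, `|f x| <= M) -> bounded_mfun f.
Proof. by move=> mf fM; split => //; exists M. Qed.

Lemma bounded_mfun_cst a : bounded_mfun (fun=> a).
Proof. by split; [exact: measurable_cst|exists `|a|]. Qed.

Lemma bounded_mfunD f g :
  bounded_mfun f -> bounded_mfun g -> bounded_mfun (fun x => f x + g x).
Proof.
move=> [mf [M fM]] [mg [N gN]]; split; first exact: measurable_funD.
by exists (M + N) => x; rewrite (le_trans (ler_normD _ _)) ?lerD.
Qed.

Lemma bounded_mfunM f g :
  bounded_mfun f -> bounded_mfun g -> bounded_mfun (fun x => f x * g x).
Proof.
move=> [mf [M fM]] [mg [N gN]]; split; first exact: measurable_funM.
by exists (M * N) => x; rewrite normrM ler_pM.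
Qed.

Lemma bounded_mfunZ a f : bounded_mfun f -> bounded_mfun (fun x => a * f x).
Proof. exact/bounded_mfunM/bounded_mfun_cst. Qed.

Lemma bounded_mfunB f g :
  bounded_mfun f -> bounded_mfun g -> bounded_mfun (fun x => f x - g x).
Proof.
move=> bf /(bounded_mfunZ (-1)) bg; have := bounded_mfunD bf bg.
by under eq_fun do rewrite mulN1r.
Qed.

Lemma bounded_mfun_norm f : bounded_mfun f -> bounded_mfun (fun x => `|f x|).
Proof.
move=> [mf [M fM]]; split; first exact: measurableT_comp.
by exists M => x; rewrite normr_id.
Qed.

Lemma bounded_mfunX f n : bounded_mfun f -> bounded_mfun (fun x => f x ^+ n).
Proof.
move=> bf; elim: n => [|n IH]; first exact: bounded_mfun_cst.
by under eq_fun do rewrite exprS; exact: bounded_mfunM.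
Qed.

Lemma bounded_mfun_sum (I : Type) (s : seq I) (F : I -> T -> R) :
  (forall i, bounded_mfun (F i)) -> bounded_mfun (fun x => \sum_(i <- s) F i x).
Proof.
move=> bF; elim: s => [|i s IH].
  by under eq_fun do rewrite big_nil; exact: bounded_mfun_cst.
by under eq_fun do rewrite big_cons; exact: bounded_mfunD.
Qed.

Lemma bounded_mfun_cos f : measurable_fun setT f ->
  bounded_mfun (fun x => cos (f x)).
Proof.
move=> mf; apply: (@bounded_mfun_le _ 1) => [|x]; last first.
  by rewrite ler_norml cos_geN1 cos_le1.
by apply: measurableT_comp mf; apply: continuous_measurable_fun; exact: continuous_cos.
Qed.

Lemma bounded_mfun_sin f : measurable_fun setT f ->
  bounded_mfun (fun x => sin (f x)).
Proof.
move=> mf; apply: (@bounded_mfun_le _ 1) => [|x]; last first.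
  by rewrite ler_norml sin_geN1 sin_le1.
by apply: measurableT_comp mf; apply: continuous_measurable_fun; exact: continuous_sin.
Qed.

Lemma bounded_mfun_indic A : measurable A -> bounded_mfun (\1_A : T -> R).
Proof.
move=> mA; apply: (@bounded_mfun_le _ 1) => [|x].
  exact: measurable_indic.
by rewrite indicE normr_nat lern1 leq_b1.
Qed.

Lemma bounded_mfun_integrable f :
  bounded_mfun f -> P.-integrable setT (EFin \o f).
Proof.
move=> [mf [M fM]]; apply: measurable_bounded_integrable => //.
  by rewrite (le_lt_trans (probability_le1 P measurableT)) ?ltry.
exists M; split; first exact: num_real.
by move=> x Mx y _ /=; rewrite (le_trans (fM y)) ?ltW.
Qed.

Lemma meanE f : bounded_mfun f -> ('E_P[f] = (mean f)%:E)%E.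
Proof.
move=> bf; rewrite unlock /mean /Rintegral fineK//.
exact/integrable_fin_num/bounded_mfun_integrable.
Qed.

Lemma mean_cst a : mean (fun=> a) = a.
Proof. by rewrite /mean Rintegral_cst//= probability_setT mulr1. Qed.

Lemma meanD f g : bounded_mfun f -> bounded_mfun g ->
  mean (fun x => f x + g x) = mean f + mean g.
Proof. by move=> bf bg; rewrite /mean RintegralD//; exact: bounded_mfun_integrable. Qed.

Lemma meanB f g : bounded_mfun f -> bounded_mfun g ->
  mean (fun x => f x - g x) = mean f - mean g.
Proof. by move=> bf bg; rewrite /mean RintegralB//; exact: bounded_mfun_integrable. Qed.

Lemma meanZ a f : bounded_mfun f -> mean (fun x => a * f x) = a * mean f.
Proof. by move=> bf; rewrite /mean RintegralZl//; exact: bounded_mfun_integrable. Qed.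

Lemma mean_sum (I : Type) (s : seq I) (F : I -> T -> R) :
  (forall i, bounded_mfun (F i)) ->
  mean (fun x => \sum_(i <- s) F i x) = \sum_(i <- s) mean (F i).
Proof.
move=> bF; elim: s => [|i s IH].
  by under eq_fun do rewrite big_nil; rewrite big_nil mean_cst.
under eq_fun do rewrite big_cons.
by rewrite big_cons -IH meanD//; exact: bounded_mfun_sum.
Qed.

Lemma le_mean f g : bounded_mfun f -> bounded_mfun g -> (forall x, f x <= g x) ->
  mean f <= mean g.
Proof.
by move=> bf bg fg; apply: le_Rintegral => //; exact: bounded_mfun_integrable.
Qed.

Lemma mean_ge0 f : (forall x, 0 <= f x) -> 0 <= mean f.
Proof. by move=> f0; exact: Rintegral_ge0. Qed.

Lemma le_norm_mean f : bounded_mfun f -> `|mean f| <= mean (fun x => `|f x|).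
Proof. by move=> bf; apply: le_normr_Rintegral => //; exact: bounded_mfun_integrable. Qed.

Lemma norm_mean_le f g : bounded_mfun f -> bounded_mfun g ->
  (forall x, `|f x| <= g x) -> `|mean f| <= mean g.
Proof.
move=> bf bg fg; rewrite (le_trans (le_norm_mean bf))// le_mean//.
exact: bounded_mfun_norm.
Qed.

Lemma norm_mean_le_cst f M : bounded_mfun f -> (forall x, `|f x| <= M) ->
  `|mean f| <= M.
Proof.
move=> bf fM; rewrite -(mean_cst M); apply: norm_mean_le => //.
exact: bounded_mfun_cst.
Qed.

Lemma dist_mean f g h : bounded_mfun f -> bounded_mfun g -> bounded_mfun h ->
  (forall x, `|f x - g x| <= h x) -> `|mean f - mean g| <= mean h.
Proof.
by move=> bf bg bh fgh; rewrite -meanB//; apply: norm_mean_le => //; exact: bounded_mfunB.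
Qed.

Lemma mean_indic A : measurable A -> mean \1_A = fine (P A).
Proof. by move=> mA; rewrite /mean /Rintegral integral_indic// setIT. Qed.

End mean.

(** * Approximation by trigonometric polynomials *)

Section bernstein.
Context {R : realType}.
Implicit Types (s c : R) (N i : nat).

(* The probability that a binomial variable of parameters N, s equals i. *)
Fixpoint bern N i s : R :=
  if N is N'.+1 then
    (if i is i'.+1 then s * bern N' i' s else 0) + (1 - s) * bern N' i s
  else (i == 0%N)%:R.

Lemma bern_ge0 N i s : 0 <= s <= 1 -> 0 <= bern N i s.
Proof.
move=> /andP[s0 s1]; elim: N i => [|N IH] [|i]//=; rewrite ?ler0n//.
  by rewrite add0r mulr_ge0 ?subr_ge0.
by rewrite addr_ge0 ?mulr_ge0 ?subr_ge0.
Qed.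

Lemma bern_gt N i s : (N < i)%N -> bern N i s = 0.
Proof.
elim: N i => [|N IH] [|i]//= Ni; rewrite !IH ?mulr0 ?addr0//.
exact: ltnW.
Qed.

(** Conditioning on one of the N + 1 trials: a success shifts the argument of [f] by one. *)
Lemma sum_bern_rec N s (f : nat -> R) :
  \sum_(i < N.+2) bern N.+1 i s * f i =
  s * (\sum_(i < N.+1) bern N i s * f i.+1) +
  (1 - s) * (\sum_(i < N.+1) bern N i s * f i).
Proof.
have -> : \sum_(i < N.+1) bern N i s * f i = \sum_(i < N.+2) bern N i s * f i.
  by rewrite [RHS]big_ord_recr/= bern_gt// mul0r addr0.
rewrite !mulr_sumr [X in _ = X + _](_ : _ = \sum_(i < N.+2)
  (if nat_of_ord i is i'.+1 then s * bern N i' s * f i'.+1 else 0)); last first.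
  rewrite [RHS]big_ord_recl/= add0r; apply: eq_bigr => i _.
  by rewrite mulrA.
rewrite -big_split/=; apply: eq_bigr => -[[|i] Hi] _ /=.
  by rewrite !add0r mulrA.
by rewrite mulrDl !mulrA.
Qed.

Lemma sum_bern N s : \sum_(i < N.+1) bern N i s = 1.
Proof.
under eq_bigr do rewrite -[bern _ _ _]mulr1.
elim: N => [|N IH]; first by rewrite big_ord1/= mulr1.
by rewrite (sum_bern_rec N s (fun=> 1)) !IH; ring.
Qed.

Lemma sum_bern_sqr N s c :
  \sum_(i < N.+1) bern N i s * (i%:R - c) ^+ 2 =
  N%:R * (s * (1 - s)) + (N%:R * s - c) ^+ 2.
Proof.
elim: N c => [|N IH] c; first by rewrite big_ord1/=; ring.
rewrite (sum_bern_rec N s (fun i => (i%:R - c) ^+ 2)) IH.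
have E i : i.+1%:R - c = i%:R - (c - 1) by rewrite -natr1; ring.
under eq_bigr do rewrite E.
by rewrite IH -natr1; ring.
Qed.

Lemma sum_bern_sqr_le N s : (0 < N)%N ->
  \sum_(i < N.+1) bern N i s * (i%:R / N%:R - s) ^+ 2 <= (4 * N%:R)^-1.
Proof.
move=> N0; have NR : 0 < N%:R :> R by rewrite ltr0n.
have -> : \sum_(i < N.+1) bern N i s * (i%:R / N%:R - s) ^+ 2 =
    (N%:R ^+ 2)^-1 * \sum_(i < N.+1) bern N i s * (i%:R - N%:R * s) ^+ 2.
  rewrite mulr_sumr; apply: eq_bigr => i _; field; exact: lt0r_neq0.
rewrite sum_bern_sqr subrr expr0n addr0.
have -> : (N%:R ^+ 2)^-1 * (N%:R * (s * (1 - s))) = (4 * N%:R)^-1 * (4 * (s * (1 - s))).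
  by field; exact: lt0r_neq0.
rewrite ler_piMr ?invr_ge0 ?mulr_ge0//.
have -> : 4 * (s * (1 - s)) = 1 - (1 - 2 * s) ^+ 2 by ring.
by rewrite gerBl sqr_ge0.
Qed.

Context {m : nat}.
Implicit Types (x t : 'I_m -> R).

(** The mass at [k] of the joint law of independent binomial variables of parameters [N] and
    [x j]. *)
Definition bern_weight N x (k : {ffun 'I_m -> 'I_N.+1}) : R :=
  \prod_j bern N (k j) (x j).

Definition bernstein N (G : ('I_m -> R) -> R) x : R :=
  \sum_(k : {ffun 'I_m -> 'I_N.+1})
    G (fun j => (k j)%:R / N%:R) * bern_weight x k.

Lemma bern_weight_ge0 N x k : (forall j, 0 <= x j <= 1) -> 0 <= @bern_weight N x k.
Proof. by move=> x01; apply: prodr_ge0 => j _; exact: bern_ge0. Qed.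

Lemma sum_bern_weight N x : \sum_k @bern_weight N x k = 1.
Proof.
rewrite -(bigA_distr_bigA (fun j (i : 'I_N.+1) => bern N i (x j))).
by rewrite big1// => j _; exact: sum_bern.
Qed.

(** By independence the sum factorizes, and every factor of index other than [l] is 1. *)
Lemma sum_bern_weight_sqr N x l : (0 < N)%N ->
  \sum_k @bern_weight N x k * ((k l)%:R / N%:R - x l) ^+ 2 <= (4 * N%:R)^-1.
Proof.
move=> N0; pose F j (i : 'I_N.+1) := bern N i (x j) *
  (if j == l then (i%:R / N%:R - x j) ^+ 2 else 1).
have -> : \sum_k @bern_weight N x k * ((k l)%:R / N%:R - x l) ^+ 2 =
    \sum_(k : {ffun 'I_m -> 'I_N.+1}) \prod_j F j (k j).
  apply: eq_bigr => k _; rewrite /F big_split/=; congr (_ * _).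
  by rewrite (bigD1 l)//= eqxx big1 ?mulr1// => j /negbTE ->.
rewrite -(bigA_distr_bigA F) (bigD1 l)//= [X in _ * X]big1 ?mulr1.
  by rewrite /F; under eq_bigr do rewrite eqxx; exact: sum_bern_sqr_le.
move=> j /negbTE jl; rewrite /F; under eq_bigr do rewrite jl mulr1.
exact: sum_bern.
Qed.

Lemma norm_bernstein_le N G x M : (forall t, `|G t| <= M) ->
  (forall j, 0 <= x j <= 1) -> `|bernstein N G x| <= M.
Proof.
move=> GM x01; rewrite (le_trans (ler_norm_sum _ _ _))//.
rewrite -[leRHS]mulr1 -(sum_bern_weight N x) mulr_sumr ler_sum// => k _.
by rewrite normrM (ger0_norm (bern_weight_ge0 _ _))// ler_wpM2r ?bern_weight_ge0.
Qed.

(** Chebyshev's inequality. A grid point within [d] of [x] in every coordinate costs at most [e]; at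
    any other one some coordinate deviates by at least [d], so the trivial bound 2 M is paid for by
    2 M / d^2 times the sum of the squared deviations, each of mean at most 1 / (4 N). *)
Lemma bernstein_close N G x (M d e : R) : (0 < N)%N -> (forall t, `|G t| <= M) ->
  (forall j, 0 <= x j <= 1) -> 0 < d -> 0 <= e ->
  (forall t, (forall j, 0 <= t j <= 1) -> (forall j, `|t j - x j| < d) ->
    `|G t - G x| <= e) ->
  `|bernstein N G x - G x| <= e + (2 * M / d ^+ 2) * (m%:R * (4 * N%:R)^-1).
Proof.
move=> N0 GM x01 d0 e0 Gx.
have M0 : 0 <= M by rewrite (le_trans _ (GM x)).
have -> : bernstein N G x - G x = \sum_(k : {ffun 'I_m -> 'I_N.+1})
    (G (fun j => (k j)%:R / N%:R) - G x) * bern_weight x k.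
  under [RHS]eq_bigr do rewrite mulrBl.
  by rewrite sumrB -mulr_sumr sum_bern_weight mulr1.
rewrite (le_trans (ler_norm_sum _ _ _))//.
have H (k : {ffun 'I_m -> 'I_N.+1}) : `|(G (fun j => (k j)%:R / N%:R) - G x) * bern_weight x k| <=
    e * @bern_weight N x k + (2 * M / d ^+ 2) *
    \sum_l bern_weight x k * ((k l)%:R / N%:R - x l) ^+ 2.
  have w0 := bern_weight_ge0 k x01.
  rewrite normrM (ger0_norm w0) -mulr_sumr mulrCA [e * _]mulrC -mulrDr mulrC.
  rewrite ler_wpM2l//.
  have S0 : 0 <= \sum_l ((k l)%:R / N%:R - x l) ^+ 2.
    by apply: sumr_ge0 => l _; exact: sqr_ge0.
  have [/forallP near|/forallPn[l]] :=
      boolP [forall j, `|(k j)%:R / N%:R - x j| < d].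
    rewrite (le_trans (Gx _ _ near))//.
      move=> j; rewrite divr_ge0//= ler_pdivrMr ?ltr0n// mul1r ler_nat.
      by rewrite -ltnS.
    by rewrite lerDl mulr_ge0// mulr_ge0 ?invr_ge0 ?sqr_ge0 ?mulr_ge0.
  rewrite -leNgt => dl.
  rewrite (@le_trans _ _ (2 * M))//.
    by rewrite (le_trans (ler_normB _ _))// mulr_natl mulr2n lerD.
  rewrite -[leLHS]add0r lerD//.
  rewrite mulrAC ler_pdivlMr ?exprn_gt0// ler_wpM2l ?mulr_ge0//.
  rewrite (bigD1 l)//= (@le_trans _ _ (((k l)%:R / N%:R - x l) ^+ 2))//.
    by rewrite -[leRHS]real_normK ?num_real// ler_sqr ?nnegrE// ltW.
  by rewrite lerDl sumr_ge0// => j _; exact: sqr_ge0.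
rewrite (le_trans (ler_sum _ (fun k _ => H k)))// big_split/=.
rewrite -mulr_sumr sum_bern_weight mulr1 lerD2l -mulr_sumr.
rewrite ler_wpM2l ?mulr_ge0 ?invr_ge0 ?sqr_ge0//.
rewrite exchange_big/= (le_trans (ler_sum _ (fun l _ => sum_bern_weight_sqr x l N0)))//.
by rewrite sumr_const card_ord [leRHS]mulr_natl.
Qed.

End bernstein.

(** * The algebra spanned by cosines of affine forms *)

Section trigonometric_polynomials.
Context {R : realType} {m : nat}.
Implicit Types (x : m.-tuple R) (u v : 'rV[R]_m) (a : R).

Definition dot u x : R := \sum_(j < m) u 0 j * tnth x j.

(** Generated as a predicate, so that statements linear in the function, such as equality or
    convergence of means, are checked on cosines and extended by induction. *)
Inductive trigpoly : (m.-tuple R -> R) -> Prop :=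
| trigpoly_cos a u : trigpoly (fun x => cos (a + dot u x))
| trigpolyD f g : trigpoly f -> trigpoly g -> trigpoly (fun x => f x + g x)
| trigpolyZ a f : trigpoly f -> trigpoly (fun x => a * f x).

Lemma dotD u v x : dot (u + v) x = dot u x + dot v x.
Proof.
rewrite /dot -big_split/=; apply: eq_bigr => j _.
by rewrite mxE mulrDl.
Qed.

Lemma dotZ a u x : dot (a *: u) x = a * dot u x.
Proof. by rewrite /dot mulr_sumr; apply: eq_bigr => j _; rewrite mxE mulrA. Qed.

Lemma dot0 x : dot 0 x = 0.
Proof. by rewrite /dot big1// => j _; rewrite mxE mul0r. Qed.

Lemma dot_delta j x : dot (delta_mx 0 j) x = tnth x j.
Proof.
rewrite /dot (bigD1 j)//= mxE !eqxx mul1r big1 ?addr0// => i ij.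
by rewrite mxE eqxx (negbTE ij) mul0r.
Qed.

Lemma trigpoly_ext f g : f =1 g -> trigpoly f -> trigpoly g.
Proof. by move=> /funext ->. Qed.

Lemma trigpoly_cst a : trigpoly (fun=> a).
Proof.
apply: trigpoly_ext (trigpolyZ a (trigpoly_cos 0 0)) => x /=.
by rewrite dot0 addr0 cos0 mulr1.
Qed.

Lemma trigpoly_cosM a u f : trigpoly f ->
  trigpoly (fun x => cos (a + dot u x) * f x).
Proof.
elim=> [b v|f1 f2 _ IH1 _ IH2|b f1 _ IH1].
- apply: trigpoly_ext (trigpolyZ 2^-1 (trigpolyD
    (trigpoly_cos (a + b) (u + v)) (trigpoly_cos (a - b) (u + (-1) *: v)))) => x.
  have -> : a + b + dot (u + v) x = a + dot u x + (b + dot v x).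
    by rewrite dotD; ring.
  have -> : a - b + dot (u + -1 *: v) x = a + dot u x - (b + dot v x).
    by rewrite dotD dotZ; ring.
  by rewrite cosD cosB; field.
- by apply: trigpoly_ext (trigpolyD IH1 IH2) => x /=; rewrite mulrDr.
- by apply: trigpoly_ext (trigpolyZ b IH1) => x /=; rewrite mulrCA.
Qed.

Lemma trigpolyM f g : trigpoly f -> trigpoly g -> trigpoly (fun x => f x * g x).
Proof.
move=> + tg; elim=> [a u|f1 f2 _ IH1 _ IH2|b f1 _ IH1].
- exact: trigpoly_cosM.
- by apply: trigpoly_ext (trigpolyD IH1 IH2) => x /=; rewrite mulrDl.
- by apply: trigpoly_ext (trigpolyZ b IH1) => x /=; rewrite mulrA.
Qed.

Lemma trigpoly_sin u : trigpoly (fun x => sin (dot u x)).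
Proof.
apply: trigpoly_ext (trigpoly_cos (- (pi / 2)) u) => x /=.
by rewrite cosD cosN sinN cos_pihalf sin_pihalf mul0r add0r mulN1r opprK.
Qed.

Lemma trigpoly_sum (I : Type) (s : seq I) (F : I -> m.-tuple R -> R) :
  (forall i, trigpoly (F i)) -> trigpoly (fun x => \sum_(i <- s) F i x).
Proof.
move=> tF; elim: s => [|i s IH].
  by apply: trigpoly_ext (trigpoly_cst 0) => x; rewrite big_nil.
by apply: trigpoly_ext (trigpolyD (tF i) IH) => x; rewrite big_cons.
Qed.

Lemma trigpoly_prod (I : Type) (s : seq I) (F : I -> m.-tuple R -> R) :
  (forall i, trigpoly (F i)) -> trigpoly (fun x => \prod_(i <- s) F i x).
Proof.
move=> tF; elim: s => [|i s IH].
  by apply: trigpoly_ext (trigpoly_cst 1) => x; rewrite big_nil.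
by apply: trigpoly_ext (trigpolyM (tF i) IH) => x; rewrite big_cons.
Qed.

Lemma trigpoly_bern N i f : trigpoly f -> trigpoly (fun x => bern N i (f x)).
Proof.
move=> tf; elim: N i => [|N IH] i; first exact: trigpoly_cst.
apply: (@trigpolyD (fun x => if i is i'.+1 then f x * bern N i' (f x) else 0)).
  by case: i => [|i]; [exact: trigpoly_cst|exact: trigpolyM].
apply: (@trigpolyM (fun x => 1 - f x)) => //.
apply: trigpoly_ext (trigpolyD (trigpoly_cst 1) (trigpolyZ (-1) tf)) => x /=.
by rewrite mulN1r.
Qed.

Lemma trigpoly_bernstein N G (f : 'I_m -> m.-tuple R -> R) :
  (forall j, trigpoly (f j)) ->
  trigpoly (fun x => bernstein N G (fun j => f j x)).
Proof.
move=> tf; apply: trigpoly_sum => k; apply: trigpolyZ.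
by apply: trigpoly_prod => j; exact: trigpoly_bern.
Qed.

Lemma measurable_dot u : measurable_fun setT (dot u).
Proof.
apply: measurable_sum => j; apply: measurable_funM => //.
exact: measurable_tnth.
Qed.

Lemma trigpoly_measurable f : trigpoly f -> measurable_fun setT f.
Proof.
elim=> [a u|g h _ IH1 _ IH2|a g _ IH].
- apply: measurableT_comp.
    by apply: continuous_measurable_fun; exact: continuous_cos.
  by apply: measurable_funD => //; exact: measurable_dot.
- exact: measurable_funD.
- exact: measurable_funM.
Qed.

(* The clipping keeps the argument inside the open interval on which arcsine is
   known to be continuous. *)
Definition clipped_asin (y : R) : R :=
  asin ((`|y + sin 2^-1| - `|y - sin 2^-1|) / 2).

Lemma sin_half_lt1 : 0 < sin (2^-1 : R) < 1.
Proof.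
have p1 := @pihalf_ge1 R.
rewrite sin_gt0_pihalf/=; last by apply/andP; split; lra.
rewrite -[ltRHS](@sin_pihalf R) ltr_sin ?in_itv/=; try (apply/andP; split); lra.
Qed.

Lemma clipped_asinK y : `|y| <= 2^-1 -> clipped_asin (sin y) = y.
Proof.
have p1 := @pihalf_ge1 R.
rewrite ler_norml => /andP[y1 y2]; rewrite /clipped_asin.
have yP : y \in `[(- (pi / 2)), pi / 2] by rewrite in_itv/=; apply/andP; split; lra.
have hP : 2^-1 \in `[(- (pi / 2)), (pi / 2 : R)] by rewrite in_itv/=; apply/andP; split; lra.
have nP : - 2^-1 \in `[(- (pi / 2)), (pi / 2 : R)] by rewrite in_itv/=; apply/andP; split; lra.
have leP : {in `[(- (pi / 2)), (pi / 2 : R)] &, {mono sin : x y / x <= y}}.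
  by apply: le_mono_in => a b aP bP; rewrite ltr_sin.
have h1 : sin y <= sin 2^-1 by rewrite leP.
have h2 : - sin 2^-1 <= sin y by rewrite -sinN leP.
(* Since [sin y] lies between - sin (1/2) and sin (1/2), the clipping returns it unchanged. *)
rewrite ger0_norm; last by lra.
rewrite ler0_norm; last by lra.
by rewrite -[RHS]sinK//; congr asin; lra.
Qed.

Lemma continuous_clipped_asin : continuous clipped_asin.
Proof.
move=> y; apply: continuous_comp.
  apply: (@continuousM R R^o); last exact: cst_continuous.
  apply: (@continuousB R R^o R^o).
    apply: (@continuous_comp R^o R^o R^o _ Num.norm); last exact: norm_continuous.
    by apply: (@continuousD R R^o R^o); [|exact: cst_continuous].
  apply: (@continuous_comp R^o R^o R^o _ Num.norm); last exact: norm_continuous.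
  by apply: (@continuousB R R^o R^o); [|exact: cst_continuous].
apply: continuous_asin.
have /andP[s0 s1] := sin_half_lt1.
(* By the reverse triangle inequality the clipped value is at most sin (1/2) < 1 in absolute value,
   whatever [y] is. *)
have h1 := ler_normB (y + sin 2^-1) (y - sin 2^-1).
have := lerB_dist (y + sin 2^-1) (y - sin 2^-1).
have := lerB_dist (y - sin 2^-1) (y + sin 2^-1).
have -> : y + sin 2^-1 - (y - sin 2^-1) = 2 * sin 2^-1 by ring.
have -> : y - sin 2^-1 - (y + sin 2^-1) = - (2 * sin 2^-1) by ring.
rewrite normrN (@ger0_norm _ (2 * sin 2^-1)); last by lra.
by move=> ? ?; apply/andP; split; lra.
Qed.

End trigonometric_polynomials.

Section trigonometric_approximation.
Context {R : realType} {m : nat}.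

Lemma continuous_row (U : topologicalType) (f : U -> 'I_m -> R) :
  (forall j, continuous (f ^~ j)) -> continuous (fun t => \row_j f t j : 'rV[R]_m).
Proof.
move=> cf t; apply/cvg_ballP => e e0.
have H j : \forall s \near t, ball (f t j) e (f s j).
  by have /cvg_ballP/(_ e e0) := cf j t.
near=> s; split=> // i j; rewrite !mxE.
by move: j; near: s; exact: filter_forall.
Unshelve. all: by end_near. Qed.

(** Heine's theorem, from the near-covering form of compactness: a radius that works near each point
    of the cube can be chosen once for all. *)
Lemma uniformly_continuous_cube (g : 'rV[R]_m -> R) e : continuous g -> 0 < e ->
  exists2 d, 0 < d & forall x y : 'rV[R]_m, (forall j, 0 <= x 0 j <= 1) ->
    (forall j, `|y 0 j - x 0 j| < d) -> `|g y - g x| <= e.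
Proof.
move=> cg e0.
have /compact_near_coveringP cK : compact [set v : 'rV[R]_m | forall j, `[0, 1]%classic (v ord0 j)].
  exact: (@rV_compact R m (fun=> `[0, 1]%classic) (fun=> @segment_compact R 0 1)).
have /cK : forall x : 'rV[R]_m, [set v | forall j, `[0, 1]%classic (v ord0 j)] x ->
    \forall x' \near x & d \near (0 : R)^'+,
    forall y, ball x' d y -> `|g y - g x'| <= e.
  move=> x _; have /cvg_ballP/(_ (e / 2)) := cg x.
  rewrite divr_gt0// => /(_ isT)/nbhs_ballP[r /= r0 Hr].
  exists (ball x (r / 2), [set d | d < r / 2]).
    split => /=; first by apply: nbhsx_ballx; rewrite divr_gt0.
    by apply: nbhs_right_lt; rewrite divr_gt0.
  move=> [x' d]/= [xx' dr] y x'y.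
  have h1 : `|g x - g y| < e / 2.
    apply: Hr => /=; rewrite [r]splitr; apply: ball_triangle xx' _.
    exact: le_ball (ltW dr) _ x'y.
  have h2 : `|g x - g x'| < e / 2.
    by apply: Hr; apply: le_ball xx'; rewrite ler_pdivrMr// ler_peMr ?ltW// ltr1n.
  rewrite (_ : g y - g x' = (g x - g x') - (g x - g y)); last by ring.
  by rewrite (le_trans (ler_normB _ _))// [leRHS]splitr lerD ?ltW.
move=> near0.
near (0 : R)^'+ => d; exists d; first by near: d; exact: nbhs_right_gt.
move=> x y x01 yx.
have /(_ x) : [set v : 'rV[R]_m | forall j, `[0, 1]%classic (v ord0 j)] `<=`
    [set x' | forall y, ball x' d y -> `|g y - g x'| <= e].
  by near: d.
apply => [j|]; first by rewrite /= in_itv/=.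
split; first by near: d; exact: nbhs_right_gt.
by move=> i j; rewrite ord1 /ball/= distrC.
Unshelve. all: by end_near. Qed.

(** The bound [M] holds on the whole space, not only on the box, because a Bernstein polynomial is
    an average of values of the function it approximates. *)
Lemma trigpoly_approx (g : 'rV[R]_m -> R) M L e : continuous g ->
  (forall x, `|g x| <= M) -> 0 < L -> 0 < e ->
  exists h : m.-tuple R -> R, [/\ trigpoly h, (forall x, `|h x| <= M) &
    forall x, (forall j, `|tnth x j| <= L) -> `|h x - g (row_of_tuple x)| <= e].
Proof.
move=> cg gM L0 e0.
(* [Phi] undoes [s] on the box. Scaling by 2 * L rather than L keeps the argument of the sine within
   [-1/2, 1/2], where the clipped arcsine is its inverse. *)
pose Phi (v : 'rV[R]_m) : 'rV[R]_m := \row_j (2 * L * clipped_asin (2 * v 0 j - 1)).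
pose G (s : 'I_m -> R) : R := g (Phi (\row_j s j)).
pose s (x : m.-tuple R) (j : 'I_m) : R := (1 + sin ((2 * L)^-1 * tnth x j)) / 2.
have cPhi : continuous Phi.
  apply: continuous_row => j v.
  apply: (@continuousM R 'rV[R]_m (cst (2 * L))
    (fun v => clipped_asin (2 * v 0 j - 1))); first exact: cst_continuous.
  apply: (@continuous_comp _ R R (fun v : 'rV[R]_m => 2 * v 0 j - 1)); last exact: continuous_clipped_asin.
  apply: (@continuousB R R^o 'rV[R]_m); last exact: cst_continuous.
  apply: (@continuousM R 'rV[R]_m (cst 2) (fun v => v 0 j)); first exact: cst_continuous.
  exact: coord_continuous.
have [d d0 Hd] := @uniformly_continuous_cube (g \o Phi) (e / 2)
  (fun v => continuous_comp (cPhi v) (cg _)) (divr_gt0 e0 (ltr0n _ 2)).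
have M0 : 0 <= M by rewrite (le_trans _ (gM 0)).
have s01 x j : 0 <= s x j <= 1.
  have := sin_geN1 ((2 * L)^-1 * tnth x j); have := sin_le1 ((2 * L)^-1 * tnth x j).
  by rewrite /s => ? ?; apply/andP; split; lra.
have [N N0 HN] : exists2 N, (0 < N)%N &
    (2 * M / d ^+ 2) * (m%:R * (4 * N%:R)^-1) <= e / 2.
  have [N N0 HN] := natr_large (2 * M / d ^+ 2 * m%:R / 4) (divr_gt0 e0 (ltr0n _ 2)).
  by exists N => //; rewrite (invfM 4) !mulrA.
exists (fun x => bernstein N G (fun j => s x j)); split.
- apply: trigpoly_bernstein => j.
  apply: trigpoly_ext (trigpolyZ 2^-1 (trigpolyD (trigpoly_cst 1)
    (trigpoly_sin ((2 * L)^-1 *: delta_mx 0 j)))) => x.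
  by rewrite /= dotZ dot_delta mulrC.
- by move=> x; apply: norm_bernstein_le => // t; exact: gM.
- move=> x xL.
  have -> : g (row_of_tuple x) = G (s x).
    congr g; apply/rowP => j; rewrite !mxE /s.
    have -> : 2 * ((1 + sin ((2 * L)^-1 * tnth x j)) / 2) - 1 = sin ((2 * L)^-1 * tnth x j).
      by field.
    rewrite clipped_asinK; last first.
      rewrite normrM ger0_norm; last by rewrite invr_ge0 mulr_ge0// ltW.
      have -> : (2 * L)^-1 * `|tnth x j| = 2^-1 * (`|tnth x j| / L).
        by field; rewrite gt_eqF.
      by rewrite ler_piMr// ler_pdivrMr// mul1r.
    by rewrite mulrA divff ?mul1r// mulf_neq0// gt_eqF.
  rewrite (le_trans (@bernstein_close _ _ N G (s x) M d (e / 2) _ _ _ _ _ _))//.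
  + by move=> t; exact: gM.
  + by rewrite divr_ge0// ltW.
  + move=> t t01 ts; apply: Hd => j; rewrite !mxE//; exact: ts.
  + by rewrite [leRHS]splitr lerD2l.
Qed.

End trigonometric_approximation.

(** * Convergence tested on cosines *)

Lemma mean_cvg {disp} {T : measurableType disp} {R : realType}
    (P : probability T R) (f_ : nat -> T -> R) (f : T -> R) M :
  (forall n, measurable_fun setT (f_ n)) -> (forall n x, `|f_ n x| <= M) ->
  (forall x, f_ n x @[n --> \oo] --> f x) ->
  mean P (f_ n) @[n --> \oo] --> mean P f.
Proof.
move=> mf fM ff; apply: fine_cvg; rewrite fineK; last first.
  apply: integrable_fin_num => //; apply: bounded_mfun_integrable.
  split; first exact: (measurable_fun_cvg mf).
  exists M => x; apply: (@ler_cvg_to nat \oo _ R (fun n => `|f_ n x|) (fun=> M)).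
  - exact: (cvg_norm (ff x)).
  - exact: cvg_cst.
  - exact: nearW.
apply: (@dominated_cvg _ _ _ P setT measurableT _ _ (EFin \o cst M)) => //.
- by move=> n; apply/measurable_EFinP.
- by move=> x _; apply: cvg_EFin; [exact: nearW|exact: ff].
- by apply: bounded_mfun_integrable; exact: bounded_mfun_cst.
- by move=> n x _; rewrite lee_fin.
Qed.

Section trigonometric_functions_determine.
Context {R : realType}.

(** Take the box of half-width n + 1 and the error 1 / (n + 1): every point ends up in the box.
    Bounded pointwise convergence is enough to pass to the limit in means. *)
Lemma trigpoly_cvg {m} (g : 'rV[R]_m -> R) M : continuous g ->
  (forall x, `|g x| <= M) ->
  exists h : nat -> m.-tuple R -> R, [/\ forall n, trigpoly (h n),
    forall n x, `|h n x| <= M &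
    forall x, h n x @[n --> \oo] --> g (row_of_tuple x)].
Proof.
move=> cg gM.
have /choice[h /all_and3[th hM hg]] n := trigpoly_approx cg gM
  (ltr0Sn R n) (divr_gt0 ltr01 (ltr0Sn R n)).
exists h; split=> // x; apply/cvgrPdist_le => e e0.
have [N N0 HN] := natr_large 1 e0.
have [L L0 HL] := natr_large (\sum_j `|tnth x j|) (@ltr01 R).
near=> n; rewrite distrC (le_trans (hg _ _ _))//.
  move=> j; rewrite (@le_trans _ _ (\sum_j `|tnth x j|))//.
    by rewrite (bigD1 j)//= lerDl sumr_ge0.
  move: HL; rewrite ler_pdivrMr ?ltr0n// mul1r => /le_trans; apply.
  by rewrite ler_nat leqW//; near: n; exact: nbhs_infty_ge.
move: HN; rewrite !mul1r; apply: le_trans.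
rewrite lef_pV2 ?posrE ?ltr0n// ler_nat leqW//.
by near: n; exact: nbhs_infty_ge.
Unshelve. all: by end_near. Qed.

Lemma bounded_mfun_trigpoly {d} {T : measurableType d} {m}
    (X : T -> m.-tuple R) h :
  measurable_fun setT X -> trigpoly h -> bounded_mfun (h \o X).
Proof.
move=> mX; elim=> [a u|f g _ IHf _ IHg|a f _ IHf].
- apply: bounded_mfun_cos; apply: measurable_funD => //.
  exact: measurableT_comp (measurable_dot u) mX.
- exact: bounded_mfunD IHf IHg.
- exact: bounded_mfunZ IHf.
Qed.

Lemma trigpoly_mean_cvg {d1 d2} {T1 : measurableType d1}
    {T2 : measurableType d2} {m} (P1 : probability T1 R)
    (P2 : probability T2 R) (X1 : nat -> T1 -> m.-tuple R)
    (X2 : T2 -> m.-tuple R) h :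
  (forall n, measurable_fun setT (X1 n)) -> measurable_fun setT X2 ->
  (forall a u, mean P1 (fun w => cos (a + dot u (X1 n w))) @[n --> \oo] -->
               mean P2 (fun w => cos (a + dot u (X2 w)))) ->
  trigpoly h -> mean P1 (h \o X1 n) @[n --> \oo] --> mean P2 (h \o X2).
Proof.
move=> mX1 mX2 HP; elim=> [a u|f g tf IHf tg IHg|a f tf IHf]; first exact: HP.
- rewrite (meanD P2 (bounded_mfun_trigpoly mX2 tf) (bounded_mfun_trigpoly mX2 tg)).
  under eq_cvg => n do rewrite (meanD P1
    (bounded_mfun_trigpoly (mX1 n) tf) (bounded_mfun_trigpoly (mX1 n) tg)).
  exact: cvgD.
- rewrite (meanZ P2 _ (bounded_mfun_trigpoly mX2 tf)).
  under eq_cvg => n do rewrite (meanZ P1 _ (bounded_mfun_trigpoly (mX1 n) tf)).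
  by apply: cvgM => //; exact: cvg_cst.
Qed.

Lemma trigpoly_mean_eq {d1 d2} {T1 : measurableType d1} {T2 : measurableType d2}
    {m} (P1 : probability T1 R) (P2 : probability T2 R) (X1 : T1 -> m.-tuple R)
    (X2 : T2 -> m.-tuple R) h :
  measurable_fun setT X1 -> measurable_fun setT X2 ->
  (forall a u, mean P1 (fun w => cos (a + dot u (X1 w))) =
               mean P2 (fun w => cos (a + dot u (X2 w)))) ->
  trigpoly h -> mean P1 (h \o X1) = mean P2 (h \o X2).
Proof.
move=> mX1 mX2 HP th.
apply: (@cvg_unique _ _ (mean P1 (h \o X1) @[n --> \oo])) => //.
  exact: cvg_cst.
apply: trigpoly_mean_cvg (fun=> mX1) mX2 _ th => a u.
by rewrite -HP; exact: cvg_cst.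
Qed.

Lemma mean_continuous_eq (mu nu : probability R R) (f : R -> R) M :
  (forall a u, mean mu (fun x => cos (a + u * x)) =
               mean nu (fun x => cos (a + u * x))) ->
  continuous f -> (forall x, `|f x| <= M) -> mean mu f = mean nu f.
Proof.
move=> munu cf fM; pose X (x : R) : 1.-tuple R := [tuple x].
have mX : measurable_fun setT X.
  apply/measurable_fun_tnthP => i; rewrite ord1.
  exact: measurable_id.
have cg : continuous (fun v : 'rV[R]_1 => f (v 0 0)).
  by move=> v; apply: continuous_comp; [exact: coord_continuous|exact: cf].
have [h [th hM hf]] := trigpoly_cvg cg (fun v => fM (v 0 0)).
have H (P : probability R R) : mean P (h n \o X) @[n --> \oo] --> mean P f.
  apply: (@mean_cvg _ _ _ _ _ _ M) => [n|n x|x].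
  - exact: measurableT_comp (trigpoly_measurable (th n)) mX.
  - exact: hM.
  - by have := hf (X x); rewrite mxE.
apply: (@cvg_unique _ _ (mean mu (h n \o X) @[n --> \oo])) => //; first exact: H.
have -> : (fun n => mean mu (h n \o X)) = (fun n => mean nu (h n \o X)).
  apply/funext => n; apply: trigpoly_mean_eq => // a u.
  have E (P : probability R R) : mean P (fun w => cos (a + dot u (X w))) =
      mean P (fun w => cos (a + u 0 0 * w)).
    by congr mean; apply/funext => w; rewrite /dot big_ord1.
  by rewrite !E.
exact: H.
Qed.

(** The half-lines ]-oo, x[ form a pi-system that generates the Borel sets, and the indicator of
    each is a bounded pointwise limit of continuous functions, on which [mu] and [nu] have equal
    means. *)
Lemma probability_eq (mu nu : probability R R) :
  (forall a u, mean mu (fun x => cos (a + u * x)) =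
               mean nu (fun x => cos (a + u * x))) ->
  forall B, measurable B -> mu B = nu B.
Proof.
move=> munu B mB; apply: (@measure_unique _ R _ (@RGenInftyO.G R)
  (fun n => `]-oo, n%:R[%classic) _ _ _ _ mu nu _ _ B mB).
- exact: RGenInftyO.measurableE.
- move=> _ _ [x ->] [y ->]; exists (Num.min x y).
  by apply/seteqP; split=> z /=; rewrite !in_itv/= lt_min => /andP.
- by move=> n; exists n%:R.
- rewrite -subTset => x _; have [N N0] := natr_large x (@ltr01 R).
  rewrite ler_pdivrMr ?ltr0n// mul1r => xN; exists N.+1 => //=.
  by rewrite in_itv/= (le_lt_trans xN)// ltr_nat.
- move=> _ [x ->].
  (* the continuous ramp equal to 0 before 0 and to 1 after 1 *)
  pose phi (t : R) : R := (`|t| - `|t - 1| + 1) / 2.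
  have phi1 t : 1 <= t -> phi t = 1.
    by move=> t1; rewrite /phi !ger0_norm; lra.
  have phi0 t : t <= 0 -> phi t = 0.
    by move=> t0; rewrite /phi !ler0_norm; lra.
  have phi_le t : `|phi t| <= 1.
    have h1 := ler_normB t (t - 1).
    have := lerB_dist t (t - 1); have := lerB_dist (t - 1) t.
    rewrite (_ : t - (t - 1) = 1); last by ring.
    rewrite (_ : t - 1 - t = - 1); last by ring.
    rewrite normrN normr1 => ? ?.
    by rewrite /phi ler_norml; apply/andP; split; lra.
  (* [f n] vanishes for y >= x and equals 1 as soon as n (x - y) >= 1, so the limit is the indicator
     of the open half-line exactly. *)
  pose f (n : nat) (y : R) := phi (n%:R * (x - y)).
  have cphi : continuous phi.
    move=> t; apply: (@continuousM R R^o (fun t => `|t| - `|t - 1| + 1)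
      (cst 2^-1)); last exact: cst_continuous.
    apply: (@continuousD R R^o R^o); last exact: cst_continuous.
    apply: (@continuousB R R^o R^o); first exact: norm_continuous.
    apply: (@continuous_comp R^o R^o R^o _ Num.norm); last exact: norm_continuous.
    by apply: (@continuousB R R^o R^o); [|exact: cst_continuous].
  have cf n : continuous (f n).
    move=> y; apply: (@continuous_comp R R R (fun y => n%:R * (x - y)) phi);
      last exact: cphi.
    apply: (@continuousM R R^o (cst n%:R) (fun y => x - y)).
      exact: cst_continuous.
    by apply: (@continuousB R R^o R^o); [exact: cst_continuous|].
  have H (P : probability R R) : mean P (f n) @[n --> \oo] --> fine (P `]-oo, x[%classic).
    rewrite -mean_indic//; apply: (@mean_cvg _ _ _ _ _ _ 1).
    + by move=> n; exact: continuous_measurable_fun.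
    + by move=> n y; exact: phi_le.
    + move=> y; rewrite indicE; have [xy|yx] := leP x y.
        rewrite memNset; last by rewrite /= in_itv/= ltNge xy.
        under eq_cvg do rewrite /f phi0 ?mulr_ge0_le0 ?subr_le0//.
        exact: cvg_cst.
      rewrite mem_set ?in_itv//=; apply/cvgrPdist_le => e e0.
      have xy0 : 0 < x - y by rewrite subr_gt0.
      have [N N0] := natr_large (x - y)^-1 (@ltr01 R).
      rewrite ler_pdivrMr ?ltr0n// mul1r => xyN.
      near=> n; rewrite /f phi1 ?subrr ?normr0; first exact: ltW.
      rewrite -ler_pdivrMr// mul1r (le_trans xyN)// ler_nat.
      by near: n; exact: nbhs_infty_ge.
  rewrite -[LHS]fineK ?fin_num_measure// -[RHS]fineK ?fin_num_measure//; congr EFin.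
  apply: (@cvg_unique _ _ (mean mu (f n) @[n --> \oo])) => //; first exact: H.
  have -> : (fun n => mean mu (f n)) = (fun n => mean nu (f n)).
    by apply/funext => n; exact: (mean_continuous_eq munu (cf n) (fun=> phi_le _)).
  exact: H.
- by move=> n; rewrite (le_lt_trans (probability_le1 mu _))// ltry.
Unshelve. all: by end_near. Qed.

End trigonometric_functions_determine.

(** * Weak convergence from cosines and bounded second moments *)

Section weak_convergence.
Context {R : realType} {m : nat}.
Implicit Types (x : m.-tuple R) (L : R).

(** A majorant of the indicator of the complement of the box of half-width [L]. It is controlled by
    second moments, and the minimum with 1 keeps it bounded, so that it has a mean under any
    probability. *)
Definition tail L x : R := Num.min 1 (\sum_j tnth x j ^+ 2 / L ^+ 2).

Lemma tail_ge0 L x : 0 <= tail L x.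
Proof.
rewrite /tail le_min ler01/= sumr_ge0// => j _.
by rewrite divr_ge0 ?sqr_ge0.
Qed.

Lemma tail_le1 L x : tail L x <= 1.
Proof. by rewrite /tail ge_min lexx. Qed.

Lemma tail_eq1 L x : 0 < L -> ~ (forall j, `|tnth x j| <= L) -> tail L x = 1.
Proof.
move=> L0 /existsNP[j /negP]; rewrite -ltNge => Lj.
rewrite /tail; apply/min_idPl; rewrite (bigD1 j)//= -[leLHS]addr0 lerD//.
  rewrite ler_pdivlMr ?exprn_gt0// mul1r -[leRHS]real_normK ?num_real//.
  by rewrite ler_sqr ?nnegrE// ltW.
by rewrite sumr_ge0// => i _; rewrite divr_ge0 ?sqr_ge0.
Qed.

Lemma measurable_tail L : measurable_fun setT (tail L).
Proof.
apply: measurable_minr; first exact: measurable_cst.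
apply: measurable_sum => j; apply: measurable_funM => //.
by apply: measurable_funX; exact: measurable_tnth.
Qed.

Lemma bounded_mfun_tail {d} {T : measurableType d} (X : T -> m.-tuple R) L :
  measurable_fun setT X -> bounded_mfun (tail L \o X).
Proof.
move=> mX; apply: (@bounded_mfun_le _ _ _ _ 1).
  exact: measurableT_comp (measurable_tail L) mX.
by move=> w; rewrite /= ger0_norm ?tail_ge0 ?tail_le1.
Qed.

Lemma mean_tail_cvg (mu : probability (m.-tuple R) R) :
  mean mu (tail n.+1%:R) @[n --> \oo] --> (0 : R).
Proof.
rewrite -(mean_cst mu 0); apply: (@mean_cvg _ _ _ _ _ _ 1) => [n|n x|x].
- exact: measurable_tail.
- by rewrite ger0_norm ?tail_ge0 ?tail_le1.
- apply/cvgrPdist_le => e e0.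
  have [N N0] := natr_large (\sum_j tnth x j ^+ 2) e0.
  rewrite ler_pdivrMr ?ltr0n// => HN.
  near=> n; rewrite sub0r normrN ger0_norm ?tail_ge0// /tail ge_min.
  apply/orP; right; rewrite -mulr_suml ler_pdivrMr ?exprn_gt0//.
  rewrite (le_trans HN)// ler_wpM2l ?(ltW e0)// -natrX ler_nat.
  rewrite (@leq_trans n.+1)//; last by rewrite expnS expn1 leq_pmulr.
  by rewrite leqW//; near: n; exact: nbhs_infty_ge.
Unshelve. all: by end_near. Qed.

(** The second moments make the laws of the [X n] uniformly tight; for the single law [mu],
    tightness follows by dominated convergence ([mean_tail_cvg]), without any moment. *)
Lemma weak_convergence {d} {T : measurableType d} (P : probability T R)
    (X : nat -> T -> m.-tuple R) (mu : probability (m.-tuple R) R) C :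
  (forall n j, bounded_mfun (fun w => tnth (X n w) j)) ->
  (forall n, \sum_j mean P (fun w => tnth (X n w) j ^+ 2) <= C) ->
  (forall a u, mean P (fun w => cos (a + dot u (X n w))) @[n --> \oo] -->
               mean mu (fun x => cos (a + dot u x))) ->
  cvg_in_distribution P X mu.
Proof.
move=> bX XC Xmu g cg [M gM].
have mX n : measurable_fun setT (X n).
  by apply/measurable_fun_tnthP => j; exact: (bX n j).1.
have mg : measurable_fun setT (fun x : m.-tuple R => g (row_of_tuple x)).
  have [h [th hM hg]] := trigpoly_cvg cg gM.
  apply: (measurable_fun_cvg (fun n => trigpoly_measurable (th n))) => x _.
  exact: hg.
have bgmu : bounded_mfun (fun x : m.-tuple R => g (row_of_tuple x)).
  by split=> //; exists M => x; exact: gM.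
have bg n : bounded_mfun (fun w => g (row_of_tuple (X n w))).
  by split; [exact: measurableT_comp mg (mX n)|exists M => w; exact: gM].
under eq_cvg do rewrite meanE//.
have -> : (\int[mu]_x (g (row_of_tuple x))%:E =
    (mean mu (fun x => g (row_of_tuple x)))%:E)%E.
  by rewrite -meanE// unlock.
apply: cvg_EFin; first exact: nearW.
apply/cvgrPdist_le => /= e e0.
have M0 : 0 <= M by rewrite (le_trans _ (gM 0)).
have C0 : 0 <= C.
  apply: le_trans (XC 0%N); apply: sumr_ge0 => j _; apply: mean_ge0 => w.
  exact: sqr_ge0.
(* Chosen so that M * e' <= e / 8; the + 1 covers M = 0. *)
pose e' := e / 8 / (M + 1).
have e'0 : 0 < e' by rewrite !divr_gt0// ltr_wpDl.
have Me' : M * e' <= e / 8.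
  rewrite /e' mulrA ler_pdivrMr ?ltr_wpDl// mulrDr mulr1 mulrC lerDl.
  by rewrite divr_ge0// ltW.
have [L L0 [XL muL]] : exists2 L, 0 < L & (forall n, mean P (tail L \o X n) <= e') /\
    mean mu (tail L) <= e'.
  have [N N0] := natr_large C e'0.
  rewrite ler_pdivrMr ?ltr0n// => HN.
  have /cvgrPdist_le/(_ _ e'0)[K _ HK] := mean_tail_cvg mu.
  exists (maxn N K).+1%:R; first exact: ltr0Sn.
  split=> [n|]; last first.
    have := HK (maxn N K) (leq_maxr _ _).
    by rewrite sub0r normrN; apply: le_trans; exact: ler_norm.
  set L := _.+1%:R; have L0 : 0 < L :> R by exact: ltr0Sn.
  apply: (@le_trans _ _ (L^-1 ^+ 2 * C)); last first.
    rewrite exprVn mulrC ler_pdivrMr ?exprn_gt0// (le_trans HN)// ler_wpM2l ?(ltW e'0)//.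
    rewrite -natrX ler_nat (@leq_trans (maxn N K).+1)//.
      by rewrite leqW// leq_maxl.
    by rewrite expnS expn1 leq_pmulr.
  apply: (@le_trans _ _ (L^-1 ^+ 2 * \sum_j mean P (fun w => tnth (X n w) j ^+ 2))).
    have b2 j : bounded_mfun (fun w => tnth (X n w) j ^+ 2) by exact: bounded_mfunX.
    rewrite -mean_sum// -meanZ; last exact: bounded_mfun_sum.
    apply: le_mean => [||w].
    - exact: bounded_mfun_tail.
    - by apply: bounded_mfunZ; exact: bounded_mfun_sum.
    - rewrite /= /tail ge_min; apply/orP; right.
      by rewrite -mulr_suml mulrC exprVn.
  by rewrite ler_wpM2l// exprn_ge0// invr_ge0 ltW.
have [h [th hM hg]] := trigpoly_approx cg gM L0 (divr_gt0 e0 (ltr0n _ 8)).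
have ghL x : `|h x - g (row_of_tuple x)| <= e / 8 + 2 * M * tail L x.
  have [xL|xL] := pselect (forall j, `|tnth x j| <= L).
    by rewrite (le_trans (hg x xL))// lerDl mulr_ge0 ?tail_ge0// mulr_ge0.
  rewrite tail_eq1// mulr1 (le_trans (ler_normB _ _))//.
  by have := hM x; have := gM (row_of_tuple x); lra.
(* e / 8 comes from the box and 2 M e' <= 2 e / 8 from outside it. Used for [X n] and for [mu], with
   another e / 8 between the means of [h], this amounts to 7 e / 8. *)
have dist d' (T' : measurableType d') (Q : probability T' R) (Z : T' -> m.-tuple R) :
    measurable_fun setT Z -> mean Q (tail L \o Z) <= e' ->
    `|mean Q (h \o Z) - mean Q (fun w => g (row_of_tuple (Z w)))| <= e * (3 / 8).
  move=> mZ ZL.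
  apply: (@le_trans _ _ (mean Q (fun w => e / 8 + 2 * M * tail L (Z w)))).
    apply: dist_mean => [|||w]; last exact: ghL.
    - exact: bounded_mfun_trigpoly.
    - by split; [exact: measurableT_comp mg mZ|exists M => w; exact: gM].
    - apply: bounded_mfunD; first exact: bounded_mfun_cst.
      by apply: bounded_mfunZ; exact: bounded_mfun_tail.
  rewrite meanD; [|exact: bounded_mfun_cst|by apply: bounded_mfunZ; exact: bounded_mfun_tail].
  rewrite mean_cst meanZ; last exact: bounded_mfun_tail.
  rewrite (_ : e * (3 / 8) = e / 8 + 2 * (e / 8)); last by field.
  rewrite lerD2l -mulrA ler_wpM2l// (le_trans _ Me')// ler_wpM2l//.
have hX := trigpoly_mean_cvg mX (@measurable_id _ _ _) Xmu th.
move/cvgrPdist_le : hX => /(_ (e / 8)) hX.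
near=> n.
have d1 := dist _ _ P (X n) (mX n) (XL n).
have d2 := dist _ _ mu id (@measurable_id _ _ _) muL.
have d3 : `|mean mu (h \o id) - mean P (h \o X n)| <= e / 8.
  by near: n; apply: hX; rewrite divr_gt0.
move: d1 d2 d3; rewrite /=.
set A := mean P (h \o X n); set B := mean mu (h \o id).
set A' := mean P (fun w => _); set B' := mean mu (fun w => _).
rewrite !ler_norml => /andP[? ?] /andP[? ?] /andP[? ?].
by apply/andP; split; lra.
Unshelve. all: by end_near. Qed.

End weak_convergence.

(** * Gaussian measures *)

Section normal_characteristic_function.
Context {R : realType}.
Variables (sigma : R) (sigma0 : sigma != 0).
Notation lebesgue := (@lebesgue_measure R).
Notation pdf := (@normal_pdf R 0 sigma).

Lemma integral_normal_prob (f : R -> R) : bounded_mfun f ->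
  mean (normal_prob 0 sigma) f = \int[lebesgue]_y (f y * pdf y).
Proof.
move=> bf; rewrite /mean /Rintegral; congr fine.
rewrite -(Radon_Nikodym_change_of_variables (normal_prob_dominates 0 sigma))//=; last first.
  exact: bounded_mfun_integrable.
under [RHS]eq_integral do rewrite EFinM.
apply: ae_eq_integral => //.
- apply: emeasurable_funM => //; first by apply/measurable_EFinP; exact: bf.1.
  apply: (measurable_int lebesgue).
  by apply: Radon_Nikodym_integrable; exact: normal_prob_dominates.
- apply: emeasurable_funM => //=; first by apply/measurable_EFinP; exact: bf.1.
  by apply/measurable_EFinP; exact: measurable_normal_pdf.
- apply: ae_eqe_mul2l => /=.
  rewrite Radon_NikodymE//=; first exact: normal_prob_dominates.
  move=> dom; case: cid => /= h [h1 h2 h3].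
  apply: integral_ae_eq => //=.
  + by apply/measurable_EFinP; exact: measurable_normal_pdf.
  + by move=> E _ mE; rewrite -h3.
Qed.

Lemma is_derive_normal_pdf (y : R) :
  is_derive y 1 pdf (- (y / sigma ^+ 2) * pdf y).
Proof.
have s2 : sigma ^+ 2 != 0 by rewrite expf_neq0.
pose c := - (2 * sigma ^+ 2)^-1.
have -> : pdf = fun x => normal_peak sigma * expR (c * (x * x)).
  apply/funext => x; rewrite normal_pdfE// /normal_fun; congr (_ * expR _).
  by rewrite /c; field.
have H : is_derive y 1 (fun x : R => c * (x * x)) (c * (2 * y)).
  have := is_derive_mul (is_derive_cst c y 1) (is_derive_mul (is_derive_id y 1) (is_derive_id y 1)).
  by move=> H; apply: (is_derive_eq H) => /=; ring.
have := is_derive_mul (is_derive_cst (normal_peak sigma) y 1)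
  (@is_derive1_comp R expR (fun x => c * (x * x)) y _ _ (is_derive_expR _) H).
by move=> H'; apply: (is_derive_eq H') => /=; rewrite /c; field.
Qed.

(** A normal density of doubled deviation serves as integrable majorant of y * pdf y and also shows
    that pdf y is O(1 / |y|). With t = |y| / |sigma| the claim reduces to t <= 2 exp (3 t^2 / 8). *)
Lemma normal_pdf_le (y : R) : `|y| * pdf y <=
  (2 * `|sigma| * (normal_peak sigma / normal_peak (2 * sigma))) * normal_pdf 0 (2 * sigma) y.
Proof.
have s20 : 2 * sigma != 0 by rewrite mulf_neq0.
have sg0 : 0 < `|sigma| by rewrite normr_gt0.
rewrite (normal_pdfE _ sigma0) (normal_pdfE _ s20).
have p0 := normal_peak_gt0 sigma0; have p1 := normal_peak_gt0 s20.
rewrite (_ : 2 * `|sigma| * (_ / _) * _ =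
  normal_peak sigma * (2 * `|sigma| * normal_fun 0 (2 * sigma) y)); last first.
  by field; rewrite gt_eqF.
rewrite mulrCA ler_wpM2l ?(ltW p0)// /normal_fun subr0.
pose t := `|y| / `|sigma|.
have yE : `|y| = t * `|sigma| by rewrite /t divfK ?gt_eqF.
have t2 : y ^+ 2 = t ^+ 2 * sigma ^+ 2.
  by rewrite -(real_normK (num_real y)) -(real_normK (num_real sigma)) yE exprMn.
have -> : - y ^+ 2 / ((2 * sigma) ^+ 2 *+ 2) =
    - y ^+ 2 / (sigma ^+ 2 *+ 2) + 3 / 8 * t ^+ 2.
  by rewrite t2; field.
rewrite expRD mulrCA [leLHS]mulrC ler_wpM2l ?expR_ge0// yE.
rewrite (mulrC t) (mulrC 2) -[leRHS]mulrA ler_wpM2l//.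
have h := expR_ge1Dx (3 / 8 * t ^+ 2); have h2 := sqr_ge0 (t - 1).
rewrite (le_trans _ (ler_wpM2l (ler0n R 2) h))//.
have -> : t = (t ^+ 2 + 1 - (t - 1) ^+ 2) / 2 by field.
rewrite expr2 in h2 *; have h3 := sqr_ge0 t; rewrite expr2 in h3 *; lra.
Qed.

Lemma integrable_mul_pdf (f : R -> R) : bounded_mfun f ->
  lebesgue.-integrable setT (fun y => (f y * pdf y)%:E).
Proof.
move=> [mf [M fM]].
apply: (@le_integrable _ _ _ lebesgue setT measurableT _ (fun y => (M * pdf y)%:E)).
- apply/measurable_EFinP/measurable_funM => //; exact: measurable_normal_pdf.
- move=> y _; rewrite lee_fin !normrM ler_wpM2r// (le_trans (fM y))// ler_norm//.
- under eq_fun do rewrite EFinM.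
  apply: integrableZl => //; exact: integrable_normal_pdf.
Qed.

Lemma integrable_normr_mul_pdf (f : R -> R) : bounded_mfun f ->
  lebesgue.-integrable setT (fun y => (y * f y * pdf y)%:E).
Proof.
move=> [mf [M fM]].
set K := 2 * `|sigma| * (normal_peak sigma / normal_peak (2 * sigma)).
apply: (@le_integrable _ _ _ lebesgue setT measurableT _ (fun y => (M * K * normal_pdf 0 (2 * sigma) y)%:E)).
- apply/measurable_EFinP/measurable_funM => //; last exact: measurable_normal_pdf.
  exact: measurable_funM.
- move=> y _; rewrite lee_fin (le_trans _ (ler_norm _))//.
  have -> : `|y * f y * pdf y| = `|f y| * (`|y| * pdf y).
    by rewrite !normrM (ger0_norm (normal_pdf_ge0 _ _ _)) mulrCA mulrA.
  rewrite -mulrA; apply: ler_pM => //; last exact: normal_pdf_le.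
  by rewrite mulr_ge0// normal_pdf_ge0.
- under eq_fun do rewrite EFinM.
  apply: integrableZl => //; exact: integrable_normal_pdf.
Qed.

Variable a : R.

Let F (s : R) : R := \int[lebesgue]_y (cos (a + s * y) * pdf y).

Let measurable_affine s : measurable_fun setT (fun y : R => a + s * y).
Proof. by apply: measurable_funD => //; exact: measurable_funM. Qed.

Let is_derive_cos_mul_pdf (y s : R) : is_derive s 1 (fun s => cos (a + s * y) * pdf y)
  (- (y * sin (a + s * y) * pdf y)).
Proof.
have H1 : is_derive s 1 (fun s => a + s * y) y.
  have := is_derive_affine a y s.
  by under eq_fun do rewrite mulrC.
have H2 := @is_derive1_comp R cos (fun s => a + s * y) s _ _ (is_derive_cos _) H1.
have := is_derive_mul H2 (is_derive_cst (pdf y) s 1).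
by move=> H; apply: (is_derive_eq H) => /=; ring.
Qed.

Let is_derive_F (s : R) :
  is_derive s 1 F (- \int[lebesgue]_y (y * sin (a + s * y) * pdf y)).
Proof.
pose f s y := cos (a + s * y) * pdf y.
have d1f t y : partial1of2 f t y = - (y * sin (a + t * y) * pdf y).
  by rewrite partial1of2E; have [_ ->] := is_derive_cos_mul_pdf y t.
have Is : `]s - 1, s + 1[%classic s.
  by rewrite /= in_itv/=; apply/andP; split; lra.
have intf x : `]s - 1, s + 1[%classic x -> lebesgue.-integrable setT (EFin \o f x).
  by move=> _; apply: integrable_mul_pdf; exact: bounded_mfun_cos.
have derf x y : `]s - 1, s + 1[%classic x -> setT y -> derivable (f ^~ y) x 1.
  by move=> _ _; have [] := is_derive_cos_mul_pdf y x.
pose G y := `|y * pdf y|.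
have intG : lebesgue.-integrable setT (EFin \o G).
  apply: integrable_norm.
  have := integrable_normr_mul_pdf (bounded_mfun_cst 1).
  by under eq_fun do rewrite mulr1.
have Gub x y : `]s - 1, s + 1[%classic x -> setT y -> `|partial1of2 f x y| <= G y.
  move=> _ _; rewrite d1f normrN /G !normrM -mulrA mulrCA ler_piMl ?mulr_ge0//.
  exact: sin_max.
have D := derivable_under_integral measurableT Is intf derf (fun y => normr_ge0 _) intG Gub.
have E := differentiation_under_integral measurableT Is intf derf (fun y => normr_ge0 _) intG Gub.
apply: DeriveDef; first exact: D.
rewrite -derive1E E -mulN1r -RintegralZl//.
  by apply: eq_Rintegral => y _; rewrite d1f mulN1r.
by apply: integrable_normr_mul_pdf; exact: bounded_mfun_sin.
Qed.

Let is_derive_sin_mul_pdf (s y : R) :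
  is_derive y 1 (fun y => sin (a + s * y) * pdf y)
    (s * cos (a + s * y) * pdf y - (sigma ^+ 2)^-1 * (y * sin (a + s * y) * pdf y)).
Proof.
have H2 := @is_derive1_comp R sin (fun y => a + s * y) y _ _ (is_derive_sin _) (is_derive_affine a s y).
have H := is_derive_mul H2 (is_derive_normal_pdf y).
by apply: (is_derive_eq H) => /=; ring.
Qed.

Let sin_mul_pdf_cvg0 s (e : nat -> R) : (forall n, `|e n| = n.+1%:R) ->
  sin (a + s * e n) * pdf (e n) @[n --> \oo] --> (0 : R).
Proof.
move=> en; apply/cvgrPdist_le => r r0.
set K := 2 * `|sigma| * (normal_peak sigma / normal_peak (2 * sigma)).
have s20 : 2 * sigma != 0 by rewrite mulf_neq0.
have [N N0] := natr_large (K * normal_peak (2 * sigma)) r0.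
rewrite ler_pdivrMr ?ltr0n// => HN.
near=> n; rewrite sub0r normrN normrM.
have p0 := normal_pdf_ge0 0 sigma (e n).
rewrite (@le_trans _ _ (pdf (e n)))//.
  by rewrite [X in _ * X]ger0_norm// ler_piMl// sin_max.
rewrite -(@ler_pM2l _ n.+1%:R) ?ltr0n// -{1}en (le_trans (normal_pdf_le _))//.
apply: (@le_trans _ _ (K * normal_peak (2 * sigma))).
  have K0 : 0 <= K by rewrite /K !mulr_ge0 ?invr_ge0 ?normal_peak_ge0.
  by rewrite ler_wpM2l ?normal_pdf_ub.
rewrite (le_trans HN)// mulrC ler_wpM2r ?(ltW r0)// ler_nat leqW//.
by near: n; exact: nbhs_infty_ge.
Unshelve. all: by end_near. Qed.

(** Integration by parts: the derivative [g] of sin (a + s y) pdf y has integral 0, being integrable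
    on the line with boundary terms at - n - 1 and n + 1 that tend to 0. With [is_derive_F] this
    reads F' = - sigma^2 s F. *)
Let integral_sin_pdf s : \int[lebesgue]_y (y * sin (a + s * y) * pdf y) =
  sigma ^+ 2 * s * F s.
Proof.
pose g y := s * cos (a + s * y) * pdf y - (sigma ^+ 2)^-1 * (y * sin (a + s * y) * pdf y).
pose H y := sin (a + s * y) * pdf y.
have ig1 : lebesgue.-integrable setT (fun y => (s * cos (a + s * y) * pdf y)%:E).
  by apply: integrable_mul_pdf; apply: bounded_mfunZ; exact: bounded_mfun_cos.
have ig2 : lebesgue.-integrable setT (fun y => (y * sin (a + s * y) * pdf y)%:E).
  by apply: integrable_normr_mul_pdf; exact: bounded_mfun_sin.
have ig2' : lebesgue.-integrable setT (fun y => ((sigma ^+ 2)^-1 * (y * sin (a + s * y) * pdf y))%:E).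
  by under eq_fun do rewrite EFinM; exact: integrableZl.
have ig : lebesgue.-integrable setT (EFin \o g).
  by under [_ \o _]eq_fun do rewrite EFinB; exact: integrableB.
have g0 : \int[lebesgue]_y g y = 0.
  have dH (y : R) : is_derive y 1 H (g y) := is_derive_sin_mul_pdf s y.
  have cH : continuous H.
    by move=> y; apply/differentiable_continuous/derivable1_diffP; have [] := dH y.
  have cg : continuous g.
    have ca : continuous (fun y => a + s * y).
      move=> y; apply/differentiable_continuous/derivable1_diffP.
      by have [] := is_derive_affine a s y.
    have cpdf : continuous pdf by exact: continuous_normal_pdf.
    have cca y : {for y, continuous (fun y => cos (a + s * y))}.
      by apply: (@continuous_comp R R R (fun y => a + s * y) cos); [exact: ca|exact: continuous_cos].
    have csa y : {for y, continuous (fun y => sin (a + s * y))}.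
      by apply: (@continuous_comp R R R (fun y => a + s * y) sin); [exact: ca|exact: continuous_sin].
    move=> y; apply: (@continuousB R R^o R^o (fun y => s * cos (a + s * y) * pdf y)).
      apply: (@continuousM R R^o (fun y => s * cos (a + s * y)) pdf); last exact: cpdf.
      by apply: (@continuousM R R^o (cst s)); [exact: cst_continuous|exact: cca].
    apply: (@continuousM R R^o (cst (sigma ^+ 2)^-1)); first exact: cst_continuous.
    apply: (@continuousM R R^o (fun y => y * sin (a + s * y)) pdf); last exact: cpdf.
    by apply: (@continuousM R R^o id).
  pose I n : set R := `[- n.+1%:R, n.+1%:R]%classic.
  have FTC n : (\int[lebesgue]_(y in I n) (g y)%:E)%E = (H n.+1%:R - H (- n.+1%:R))%:E.
    rewrite (@continuous_FTC2 _ _ H)//.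
    - by rewrite gtrN.
    - exact: continuous_subspaceT.
    - split.
      + by move=> y _; have [] := dH y.
      + by apply: cvg_at_right_filter; exact: cH.
      + by apply: cvg_at_left_filter; exact: cH.
    - by move=> y _; rewrite derive1E; have [_ ->] := dH y.
  have H0 : H n.+1%:R - H (- n.+1%:R) @[n --> \oo] --> (0 : R).
    rewrite -(subr0 0); apply: cvgB; apply: sin_mul_pdf_cvg0 => n.
      by rewrite ger0_norm.
    by rewrite normrN ger0_norm.
  have Hg : H n.+1%:R - H (- n.+1%:R) @[n --> \oo] --> \int[lebesgue]_y g y.
    have -> : (fun n => H n.+1%:R - H (- n.+1%:R)) = (fun n => fine
        (\int[lebesgue]_y ((EFin \o g) \_ (I n)) y)%E).
      by apply/funext => n; rewrite -integral_mkcond/= FTC.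
    apply: fine_cvg; rewrite fineK; last exact: integrable_fin_num.
    apply: (@dominated_cvg _ _ _ lebesgue setT measurableT _ _
      (fun y => `|(g y)%:E|%E)) => //.
    - move=> n; apply/(measurable_restrictT _ _).1; first exact: measurable_itv.
      by apply: measurable_funTS; exact: measurable_int ig.
    - move=> y _; have [N N0] := natr_large `|y| (@ltr01 R).
      rewrite ler_pdivrMr ?ltr0n// mul1r => yN.
      apply: cvg_near_cst; near=> n; apply/eqP; rewrite patchE mem_set//=.
      rewrite /I/= in_itv/= -ler_norml (le_trans yN)// ler_nat leqW//.
      by near: n; exact: nbhs_infty_ge.
    - exact: integrable_abse ig.
    - move=> n y _; rewrite patchE; case: ifPn => // _.
      by rewrite abse0.
  exact: cvg_unique Hg H0.
have : \int[lebesgue]_y g y = s * F s - (sigma ^+ 2)^-1 * \int[lebesgue]_y (y * sin (a + s * y) * pdf y).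
  rewrite /g RintegralB// [in X in _ - X = _]RintegralZl//; congr (_ - _).
  rewrite /F -RintegralZl//; last by apply: integrable_mul_pdf; exact: bounded_mfun_cos.
  by apply: eq_Rintegral => y _; rewrite mulrA.
rewrite g0 => /esym/eqP; rewrite subr_eq0 => /eqP/(congr1 (fun x => sigma ^+ 2 * x)).
by rewrite !mulrA divff ?mul1r// expf_neq0.
Unshelve. all: by end_near. Qed.

Lemma mean_normal_cos u : mean (normal_prob 0 sigma) (fun y => cos (a + u * y)) =
  cos a * expR (- (sigma ^+ 2 * u ^+ 2 / 2)).
Proof.
have -> : mean (normal_prob 0 sigma) (fun y => cos (a + u * y)) = F u.
  by rewrite integral_normal_prob//; exact: bounded_mfun_cos.
have F0 : F 0 = cos a.
  rewrite /F; under eq_Rintegral do rewrite mul0r addr0.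
  rewrite RintegralZl//; last exact: integrable_normal_pdf.
  by rewrite /Rintegral integral_normal_pdf mulr1.
(* The integrating factor of that equation: F * E has derivative 0. *)
pose E (s : R) := expR (sigma ^+ 2 / 2 * (s * s)).
have dE (s : R) : is_derive s 1 E (sigma ^+ 2 * s * E s).
  have H := is_derive_mul (is_derive_cst (sigma ^+ 2 / 2) s 1) (is_derive_mul (is_derive_id s 1) (is_derive_id s 1)).
  have H' := @is_derive1_comp R expR _ s _ _ (is_derive_expR _) H.
  by apply: (is_derive_eq H') => /=; rewrite /E; field.
have : F u * E u = F 0 * E 0.
  apply: (@is_derive_0_is_cst R (fun s => F s * E s) u 0) => s.
  apply: (is_derive_eq (is_derive_mul (is_derive_F s) (dE s))).
  by rewrite integral_sin_pdf; ring.
rewrite F0 /E !mulr0 expR0 !mulr1 => <-.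
rewrite -mulrA -expRD (_ : _ + _ = 0) ?expR0 ?mulr1//; ring.
Qed.

End normal_characteristic_function.

(** Elimination of the first coordinate, singular matrices included: a zero corner forces its row to
    vanish, and otherwise the Schur complement of the corner is again positive semidefinite. *)
Lemma cholesky {R : rcfType} m (S : 'M[R]_m) : S^T = S ->
  (forall u : 'rV_m, 0 <= (u *m S *m u^T) 0 0) ->
  exists A : 'M[R]_m, S = A *m A^T.
Proof.
elim: m S => [|m IH] S; first by move=> _ _; exists 0; apply/matrixP => -[].
move: S; rewrite -[m.+1]/(1 + m)%N => S.
rewrite -[S]submxK; set s := ulsubmx S; set b := ursubmx S.
set c := dlsubmx S; set D := drsubmx S.
rewrite tr_block_mx => /eq_block_mx[_ cT cb DT] Spos.
have {}cb : c = b^T by rewrite -cb.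
have quad t (w : 'rV_m) : (row_mx (@scalar_mx R 1 t) w *m block_mx s b c D *m
    (row_mx (@scalar_mx R 1 t) w)^T) 0 0 =
    t ^+ 2 * s 0 0 + 2 * t * (w *m b^T) 0 0 + (w *m D *m w^T) 0 0.
  rewrite tr_row_mx mul_row_block mul_row_col cb.
  rewrite !mulmxDl tr_scalar_mx !mul_scalar_mx !mul_mx_scalar.
  have aE (A B : 'M[R]_1) : (A + B) 0 0 = A 0 0 + B 0 0 by rewrite mxE.
  have zE r (A : 'M[R]_1) : (r *: A) 0 0 = r * A 0 0 by rewrite mxE.
  rewrite !(aE, zE) -scalemxAl zE.
  have -> : (b *m w^T) 0 0 = (w *m b^T) 0 0.
    by rewrite !mxE; apply: eq_bigr => j _; rewrite !mxE mulrC.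
  by ring.
have s0 : 0 <= s 0 0.
  have := Spos (row_mx (@scalar_mx R 1 1) 0).
  by rewrite quad mul0mx trmx0 mulmx0 !mxE mulr0 !addr0 expr1n mul1r.
have sE : s = (s 0 0)%:M by rewrite [LHS]mx11_scalar.
have [seq0|sneq0] := eqVneq (s 0 0) 0.
  (* With a zero corner the form at (t, w) is affine in t; a nonzero slope would let it take the
     value -1. *)
  have bw (w : 'rV_m) : (w *m b^T) 0 0 = 0.
    set x := (w *m b^T) 0 0; set y := (w *m D *m w^T) 0 0.
    apply/eqP; apply: contraT => x0.
    have := Spos (row_mx (@scalar_mx R 1 (- (y + 1) / (2 * x))) w).
    rewrite quad seq0 mulr0 add0r -/x -/y.
    rewrite (_ : 2 * (- (y + 1) / (2 * x)) * x + y = - 1); last by field.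
    by rewrite lerNr oppr0 ler10.
  have b0 : b = 0.
    apply/rowP => j; have := bw (delta_mx 0 j).
    by rewrite -rowE !mxE.
  have [|A DA] := IH D DT.
    move=> w; have := Spos (row_mx (@scalar_mx R 1 0) w).
    by rewrite quad seq0 !mulr0 mul0r !add0r.
  exists (block_mx 0 0 0 A).
  rewrite tr_block_mx !trmx0 mulmx_block !mul0mx !mulmx0 !add0r -DA.
  by rewrite cb b0 trmx0 sE seq0 raddf0.
have s1 : 0 < s 0 0 by rewrite lt_neqAle eq_sym sneq0.
pose r := Num.sqrt (s 0 0).
have rr : r * r = s 0 0 by rewrite -expr2 sqr_sqrtr.
have r0 : r != 0 by apply: contra_neq sneq0 => r0; rewrite -rr r0 mulr0.
pose D' := D - (s 0 0)^-1 *: (b^T *m b).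
have D'T : D'^T = D'.
  by rewrite /D' linearB/= linearZ/= trmx_mul trmxK DT.
have [|A DA] := IH D' D'T.
  (* This first coordinate minimizes the form for given [w]; the minimum is the form of the Schur
     complement [D']. *)
  move=> w; have := Spos (row_mx (@scalar_mx R 1 (- (w *m b^T) 0 0 / s 0 0)) w).
  rewrite quad; set x := (w *m b^T) 0 0.
  rewrite /D' mulmxBr mulmxBl -scalemxAr -scalemxAl.
  have aE (B C : 'M[R]_1) : (B - C) 0 0 = B 0 0 - C 0 0 by rewrite !mxE.
  have zE t (B : 'M[R]_1) : (t *: B) 0 0 = t * B 0 0 by rewrite mxE.
  have -> : w *m (b^T *m b) *m w^T = (w *m b^T) *m (w *m b^T)^T.
    by rewrite trmx_mul trmxK !mulmxA.
  rewrite aE zE [w *m b^T]mx11_scalar -/x tr_scalar_mx -scalar_mxM.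
  rewrite [(x * x)%:M 0 0]mxE eqxx mulr1n.
  set y := (w *m D *m w^T) 0 0.
  by congr (0 <= _); field.
exists (block_mx r%:M 0 (r^-1 *: b^T) A).
rewrite tr_block_mx trmx0 tr_scalar_mx linearZ/= trmxK mulmx_block.
rewrite !mul0mx !mulmx0 !addr0 -DA cb -scalar_mxM rr -sE.
rewrite mul_scalar_mx scalerA divff// scale1r mul_mx_scalar scalerA divff// scale1r.
rewrite -scalemxAl -scalemxAr scalerA -invfM rr /D'.
by rewrite addrCA subrr addr0.
Qed.

(** * Existence of a Gaussian law with given covariance *)

Section gaussian_existence.
Context {R : realType}.

Lemma exists_pushforward {d1 d2} {T1 : measurableType d1}
    {T2 : measurableType d2} (P : probability T1 R) (X : T1 -> T2) :
  measurable_fun setT X -> exists Q : probability T2 R,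
    (forall B, Q B = P (X @^-1` B)) /\
    (forall f, bounded_mfun f -> mean Q f = mean P (f \o X)).
Proof.
move=> mX; exists (distribution P (mfun_Sub (mem_set mX))); split=> // f bf.
rewrite /mean /Rintegral integral_distribution//; first exact/measurable_EFinP/bf.1.
by apply: bounded_mfun_integrable; split; [exact: measurableT_comp bf.1 mX|case: bf.2 => M ?; exists M].
Qed.

Lemma exists_centered_normal (v : R) : 0 <= v ->
  exists nu : probability R R, (forall B, nu B = centered_normal v B) /\
    forall a u, mean nu (fun y => cos (a + u * y)) =
      cos a * expR (- (v * u ^+ 2 / 2)).
Proof.
move=> v0; rewrite /centered_normal; have [->|vn0] := eqVneq v 0.
  exists (dirac (0 : R)); split=> // a u.
  rewrite /mean /Rintegral integral_dirac//; last first.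
    apply/measurable_EFinP; apply: (bounded_mfun_cos _).1.
    by apply: measurable_funD => //; exact: measurable_funM.
  by rewrite diracT mul1e /= mulr0 addr0 !mul0r oppr0 expR0 mulr1.
(* The image under the identity only moves the law from [measurableTypeR R] to [R]. *)
have [|Q [QE Qmean]] := @exists_pushforward _ _ _ R
  (normal_prob 0 (Num.sqrt v) : probability (measurableTypeR R) R) id.
  exact: measurable_id.
exists Q; split=> // a u; rewrite Qmean.
  rewrite mean_normal_cos; last by rewrite sqrtr_eq0 -ltNge lt_neqAle eq_sym vn0.
  by rewrite sqr_sqrtr.
apply: bounded_mfun_cos.
by apply: measurable_funD => //; exact: measurable_funM.
Qed.

Lemma mean_prod {d1 d2} {T1 : measurableType d1} {T2 : measurableType d2}
    (P1 : probability T1 R) (P2 : probability T2 R) (f : T1 * T2 -> R) :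
  bounded_mfun f ->
  mean (P1 \x P2)%E f = mean P2 (fun y => mean P1 (fun x => f (x, y))).
Proof.
move=> bf; have [mf [M fM]] := bf.
rewrite /mean /Rintegral -(@integral21_prod_meas1 _ _ _ _ _ P1 P2 (EFin \o f))//; last first.
  exact: bounded_mfun_integrable.
congr fine; apply: eq_integral => y _; rewrite /fubini_G/= fineK//.
apply: integrable_fin_num => //.
apply: (@bounded_mfun_integrable _ _ _ P1 (fun x => f (x, y))); split; last by exists M.
exact: measurableT_comp mf (measurable_pair2 y).
Qed.

(** Induction by prepending an independent coordinate. When the others are fixed, their contribution
    joins [a] as a phase in the one-dimensional formula. *)
Lemma exists_standard_gaussian m : exists nu : probability (m.-tuple R) R,
  forall a (u : 'rV[R]_m), mean nu (fun x => cos (a + dot u x)) =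
    cos a * expR (- (\sum_j u 0 j ^+ 2 / 2)).
Proof.
have [N [_ Ncos]] := exists_centered_normal ler01.
elim: m => [|m [nu IH]].
  exists (dirac ([tuple] : 0.-tuple R)) => a u.
  have -> : (fun x => cos (a + dot u x)) = (fun=> cos a).
    by apply/funext => x; rewrite /dot big_ord0 addr0.
  by rewrite mean_cst big_ord0 oppr0 expR0 mulr1.
pose X (z : R * m.-tuple R) : m.+1.-tuple R := [tuple of z.1 :: z.2].
have mX : measurable_fun setT X.
  by apply: measurable_cons; [exact: measurable_fst|exact: measurable_snd].
have [Q [_ Qmean]] := exists_pushforward (N \x nu)%E mX.
exists Q => a u; rewrite Qmean; last first.
  by apply: bounded_mfun_cos; apply: measurable_funD => //; exact: measurable_dot.
pose u' : 'rV[R]_m := \row_j u 0 (lift ord0 j).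
have dX z x : dot u (X (z, x)) = u 0 ord0 * z + dot u' x.
  rewrite /dot big_ord_recl tnth0; congr (_ + _); apply: eq_bigr => j _.
  by rewrite mxE tnthS.
rewrite mean_prod; last first.
  apply: bounded_mfun_cos; apply: measurable_funD => //.
  exact: measurableT_comp (measurable_dot u) mX.
rewrite big_ord_recl.
transitivity (mean nu (fun y => expR (- (u 0 ord0 ^+ 2 / 2)) * cos (a + dot u' y))).
  congr mean; apply/funext => y /=.
  under eq_fun do rewrite dX addrCA addrA [_ + a]addrC addrAC.
  by rewrite Ncos mul1r mulrC.
rewrite meanZ; last first.
  by apply: bounded_mfun_cos; apply: measurable_funD => //; exact: measurable_dot.
rewrite IH mulrCA -expRD opprD; congr (_ * expR (_ - _)).
by apply: eq_bigr => j _; rewrite mxE.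
Qed.

Lemma exists_gaussian m (S : 'M[R]_m) : S^T = S ->
  (forall u : 'rV_m, 0 <= (u *m S *m u^T) 0 0) ->
  exists mu : probability (m.-tuple R) R, gaussian_law S mu /\
    forall a u, mean mu (fun x => cos (a + dot u x)) =
      cos a * expR (- ((u *m S *m u^T) 0 0 / 2)).
Proof.
move=> ST Spos; have [A SE] := cholesky ST Spos.
have [nu nuE] := exists_standard_gaussian m.
pose X (x : m.-tuple R) : m.-tuple R := [tuple dot (row j A) x | j < m].
have mX : measurable_fun setT X.
  apply/measurable_fun_tnthP => j.
  have -> : (tnth (T:=R))^~ j \o X = dot (row j A).
    by apply/funext => x; rewrite /= tnth_mktuple.
  exact: measurable_dot.
have dX u x : dot u (X x) = dot (u *m A) x.
  rewrite /dot; under eq_bigr do rewrite tnth_mktuple mulr_sumr.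
  rewrite exchange_big/=; apply: eq_bigr => k _; rewrite mxE mulr_suml.
  by apply: eq_bigr => j _; rewrite mxE mulrA.
have bdot u a : bounded_mfun (fun x : m.-tuple R => cos (a + dot u x)).
  by apply: bounded_mfun_cos; apply: measurable_funD => //; exact: measurable_dot.
have [mu [_ muE]] := exists_pushforward nu mX.
have mu_cos a u : mean mu (fun x => cos (a + dot u x)) =
    cos a * expR (- ((u *m S *m u^T) 0 0 / 2)).
  rewrite muE//; under [X in mean _ X]eq_fun do rewrite /= dX.
  rewrite nuE; congr (_ * expR (- _)); rewrite -mulr_suml; congr (_ / _).
  rewrite SE !mulmxA -mulmxA -trmx_mul mxE; apply: eq_bigr => j _.
  by rewrite [(u *m A)^T j 0]mxE expr2.
exists mu; split=> //; split=> // u /=; split=> // B mB.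
set v := (u *m S *m u^T) 0 0.
(* The law of u . x under [mu] is compared with this normal law through cosines: t (u . x) is (t u)
   . x, whose cosine means under [mu] are known. *)
have [N [NE Ncos]] := exists_centered_normal (Spos u).
have [Q [QE Qmean]] := exists_pushforward mu (measurable_dot u).
rewrite -NE -[LHS](QE B); apply: probability_eq => // a t.
rewrite Ncos Qmean; last first.
  by apply: bounded_mfun_cos; apply: measurable_funD => //; exact: measurable_funM.
rewrite /comp; under eq_fun do rewrite -dotZ.
rewrite (mu_cos a (t *: u)).
have -> : ((t *: u) *m S *m (t *: u)^T) 0 0 = v * t ^+ 2.
  rewrite linearZ/= -!scalemxAl -scalemxAr scalerA [LHS]mxE -/v.
  by rewrite mulrC expr2.
by [].
Qed.

End gaussian_existence.

(** * Covariance under strong mixing *)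

Section covariance_inequality.
Context {disp : measure_display} {T : measurableType disp} {R : realType}.
Variable P : probability T R.
Implicit Types f g : T -> R.

Definition cov f g : R := mean P (fun w => f w * g w) - mean P f * mean P g.

Lemma covC f g : cov f g = cov g f.
Proof.
rewrite /cov [mean P f * _]mulrC; congr (mean P _ - _).
by apply/funext => w; rewrite mulrC.
Qed.

Lemma cov_suml (I : Type) (s : seq I) (F : I -> T -> R) g :
  (forall i, bounded_mfun (F i)) -> bounded_mfun g ->
  cov (fun w => \sum_(i <- s) F i w) g = \sum_(i <- s) cov (F i) g.
Proof.
move=> bF bg; rewrite /cov sumrB -mulr_suml -(mean_sum P s bF).
rewrite -(mean_sum P s (fun i => bounded_mfunM (bF i) bg)); congr (_ - _).
by congr mean; apply/funext => w; rewrite mulr_suml.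
Qed.

Lemma covZl a f g : bounded_mfun f -> bounded_mfun g ->
  cov (fun w => a * f w) g = a * cov f g.
Proof.
move=> bf bg; rewrite /cov meanZ// mulrBr mulrA; congr (_ - _).
rewrite -meanZ; last exact: bounded_mfunM.
by congr mean; apply/funext => w; rewrite mulrA.
Qed.

Lemma covDcstl a f g : bounded_mfun f -> bounded_mfun g ->
  cov (fun w => a + f w) g = cov f g.
Proof.
move=> bf bg; have ba : bounded_mfun (fun _ : T => a) by exact: bounded_mfun_cst.
rewrite /cov (meanD P ba bf) mean_cst; under eq_fun do rewrite mulrDl.
rewrite meanD; [|exact: bounded_mfunZ|exact: bounded_mfunM].
by rewrite meanZ//; ring.
Qed.

(* Rounds [x] in [-1, 1] down to the grid of step [2 / N]; composed with [f], it
   is an affine combination of indicators of the sets [f >= t]. *)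
Definition staircase N (x : R) : R :=
  -1 + 2 / N%:R * \sum_(i < N) (i.+1%:R / N%:R * 2 - 1 <= x)%R%:R.

Lemma count_floor N (z : R) : 0 <= z <= N%:R ->
  z - 1 <= \sum_(i < N) (i.+1%:R <= z)%R%:R <= z.
Proof.
move=> /andP[z0 zN]; apply/andP; split; last first.
  elim: N {zN} => [|N IH]; first by rewrite big_ord0.
  rewrite big_ord_recr/=; have [Nz|_] := leP N.+1%:R z; last by rewrite addr0.
  apply: le_trans Nz; rewrite -natr1 lerD2r -[leRHS]mulr_natl mulr1.
  rewrite (@le_trans _ _ (\sum_(i < N) 1))//; last by rewrite sumr_const card_ord.
  by apply: ler_sum => i _; rewrite lern1 leq_b1.
elim: N zN => [|N IH] zN; first by rewrite big_ord0 lerBlDr add0r (le_trans zN).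
rewrite big_ord_recr/=; have [zN'|Nz] := leP z N%:R.
  by rewrite (le_trans (IH zN'))// lerDl.
have -> : \sum_(i < N) (i.+1%:R <= z)%R%:R = N%:R :> R.
  under eq_bigr => i _.
    have -> : i.+1%:R <= z.
      by rewrite (le_trans _ (ltW Nz))// ler_nat.
    over.
  by rewrite sumr_const card_ord.
apply: (@le_trans _ _ N%:R); last by rewrite lerDl.
by rewrite lerBlDr natr1.
Qed.

Lemma staircase_close N x : (0 < N)%N -> `|x| <= 1 ->
  `|x - staircase N x| <= 2 / N%:R /\ `|staircase N x| <= 1.
Proof.
move=> N0; rewrite ler_norml => /andP[x1 x2].
have NR : 0 < N%:R :> R by rewrite ltr0n.
pose z := (x + 1) * N%:R / 2.
have zE : x = -1 + 2 / N%:R * z by rewrite /z; field; rewrite gt_eqF.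
have /count_floor : 0 <= z <= N%:R.
  rewrite /z !mulr_ge0 ?invr_ge0//=; try lra.
  by rewrite ler_pdivrMr// mulrC ler_wpM2l//; lra.
rewrite /staircase.
have -> : \sum_(i < N) (i.+1%:R / N%:R * 2 - 1 <= x)%R%:R =
    \sum_(i < N) (i.+1%:R <= z)%R%:R :> R.
  apply: eq_bigr => i _; congr ((nat_of_bool _)%:R).
  by rewrite /z ler_pdivlMr// lerBlDr mulrAC ler_pdivrMr.
set S := \sum_(i < N) _ => /andP[S1 S2].
have S0 : 0 <= S by exact: sumr_ge0.
have zN : 2 / N%:R * z <= 2 by rewrite zE in x2; lra.
have q0 : 0 <= 2 / N%:R :> R by rewrite divr_ge0.
have h1 : 2 / N%:R * S <= 2 / N%:R * z by rewrite ler_wpM2l.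
have h2 : 2 / N%:R * (z - 1) <= 2 / N%:R * S by rewrite ler_wpM2l.
have h3 : 0 <= 2 / N%:R * S by rewrite mulr_ge0.
rewrite {1}zE !ler_norml; set u := 2 / N%:R * S in h1 h2 h3 *.
by split; apply/andP; split; lra.
Qed.

Definition level f t : set T := [set w | t <= f w].

Lemma measurable_level f t : measurable_fun setT f -> measurable (level f t).
Proof.
move=> mf; rewrite (_ : level _ _ = f @^-1` `[t, +oo[%classic).
  by rewrite -[X in measurable X]setTI; exact: mf.
by apply/seteqP; split => w /=; rewrite in_itv/= andbT.
Qed.

(** For staircases bilinearity gives (2 / N)^2 times N^2 covariances of level indicators, hence 4
    kappa; additive constants do not count. *)
Lemma cov_le f g kappa : measurable_fun setT f -> measurable_fun setT g ->
  (forall w, `|f w| <= 1) -> (forall w, `|g w| <= 1) ->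
  (forall s t, `|cov \1_(level f s) \1_(level g t)| <= kappa) ->
  `|cov f g| <= 4 * kappa.
Proof.
move=> mf mg f1 g1 H.
have bf := bounded_mfun_le mf f1; have bg := bounded_mfun_le mg g1.
have bl h t : measurable_fun setT h -> bounded_mfun (\1_(level h t) : T -> R).
  by move=> mh; apply: bounded_mfun_indic; exact: measurable_level.
apply/ler_addgt0Pr => e e0.
(* Passing to staircases costs 4 / N in the mean of the product ([d1]) and 4 / N in the product of
   the means ([d2]). *)
have [N N0 HN] := natr_large 8 e0; apply: le_trans (lerD (lexx _) HN).
have NR : 0 < N%:R :> R by rewrite ltr0n.
pose thr (i : 'I_N) : R := i.+1%:R / N%:R * 2 - 1.
pose st (h : T -> R) (w : T) : R := staircase N (h w).
have stE h : st h =
    (fun w => -1 + 2 / N%:R * \sum_(i < N) \1_(level h (thr i)) w).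
  apply/funext => w; rewrite /st /staircase; congr (_ + _ * _).
  apply: eq_bigr => i _; rewrite indicE; congr ((nat_of_bool _)%:R).
  by apply/idP/idP; rewrite inE.
have bst h : measurable_fun setT h -> bounded_mfun (st h).
  move=> mh; rewrite stE; apply: bounded_mfunD; first exact: bounded_mfun_cst.
  by apply: bounded_mfunZ; apply: bounded_mfun_sum => i; exact: bl.
have cst_cov h k : measurable_fun setT h -> bounded_mfun k ->
    cov (st h) k = 2 / N%:R * \sum_(i < N) cov \1_(level h (thr i)) k.
  move=> mh bk; rewrite stE covDcstl//.
    rewrite covZl//; last by apply: bounded_mfun_sum => i; exact: bl.
    by rewrite cov_suml// => i; exact: bl.
  by apply: bounded_mfunZ; apply: bounded_mfun_sum => i; exact: bl.
have step : `|cov (st f) (st g)| <= 4 * kappa.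
  rewrite cst_cov//; last exact: bst.
  have -> : 4 * kappa = 2 / N%:R * \sum_(i < N) 2 / N%:R * \sum_(j < N) kappa.
    have sc (x : R) : \sum_(i < N) x = N%:R * x.
      by rewrite sumr_const card_ord mulr_natl.
    rewrite !sc.
    by field; rewrite gt_eqF.
  rewrite normrM ger0_norm ?divr_ge0// ler_wpM2l ?divr_ge0//.
  rewrite (le_trans (ler_norm_sum _ _ _))// ler_sum// => i _.
  rewrite covC cst_cov//; last exact: bl.
  rewrite normrM ger0_norm ?divr_ge0// ler_wpM2l ?divr_ge0//.
  rewrite (le_trans (ler_norm_sum _ _ _))// ler_sum// => j _.
  by rewrite covC.
have [fs1 fs2] := all_and2 (fun w => staircase_close N0 (f1 w)).
have [gs1 gs2] := all_and2 (fun w => staircase_close N0 (g1 w)).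
have q0 : 0 <= 2 / N%:R :> R by rewrite divr_ge0.
have d1 : `|mean P (fun w => f w * g w) - mean P (fun w => st f w * st g w)| <= 4 / N%:R.
  rewrite -meanB; [|exact: bounded_mfunM|exact: (bounded_mfunM (bst _ mf) (bst _ mg))].
  apply: norm_mean_le_cst.
    by apply: bounded_mfunB; [exact: bounded_mfunM|exact: (bounded_mfunM (bst _ mf) (bst _ mg))].
  move=> w; rewrite /st (_ : _ - _ = (f w - staircase N (f w)) * g w +
    staircase N (f w) * (g w - staircase N (g w))); last by ring.
  rewrite (le_trans (ler_normD _ _))// !normrM (_ : 4 / N%:R = 2 / N%:R * 1 + 1 * (2 / N%:R)); last by ring.
  by rewrite lerD// ler_pM.
have d2 : `|mean P f * mean P g - mean P (st f) * mean P (st g)| <= 4 / N%:R.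
  rewrite (_ : _ - _ = (mean P f - mean P (st f)) * mean P g +
    mean P (st f) * (mean P g - mean P (st g))); last by ring.
  rewrite (le_trans (ler_normD _ _))// !normrM (_ : 4 / N%:R = 2 / N%:R * 1 + 1 * (2 / N%:R)); last by ring.
  rewrite lerD// ler_pM//.
  - rewrite -meanB//; last exact: bst.
    by apply: norm_mean_le_cst => //; apply: bounded_mfunB => //; exact: bst.
  - exact: norm_mean_le_cst.
  - by apply: norm_mean_le_cst => //; exact: bst.
  - rewrite -meanB//; last exact: bst.
    by apply: norm_mean_le_cst => //; apply: bounded_mfunB => //; exact: bst.
move: step d1 d2; rewrite /cov /=.
set A := mean P _; set B := mean P _ * _; set A' := mean P _; set B' := mean P _ * _.
rewrite (_ : 8 / N%:R = 4 / N%:R + 4 / N%:R); last by ring.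
by rewrite !ler_norml => /andP[? ?] /andP[? ?] /andP[? ?]; apply/andP; split; lra.
Qed.

Lemma cov_indic A B : measurable A -> measurable B ->
  ((cov \1_A \1_B)%:E = P (A `&` B) - P A * P B)%E.
Proof.
move=> mA mB; rewrite /cov.
have -> : (fun w => \1_A w * \1_B w) = \1_(A `&` B) :> (T -> R).
  by apply/funext => w; rewrite indicI.
rewrite !mean_indic//; last exact: measurableI.
by rewrite EFinB EFinM !fineK ?fin_num_measure//; exact: measurableI.
Qed.

Lemma alpha_sets_cov (F G : set (set T)) f g kappa :
  (alpha_sets P F G <= kappa%:E)%E ->
  measurable_fun setT f -> measurable_fun setT g ->
  (forall w, `|f w| <= 1) -> (forall w, `|g w| <= 1) ->
  (forall t, F (level f t)) -> (forall t, G (level g t)) ->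
  `|cov f g| <= 4 * kappa.
Proof.
move=> FG mf mg f1 g1 Ff Gg; apply: cov_le => // s t.
have mfs := measurable_level s mf; have mgt := measurable_level t mg.
rewrite -lee_fin; apply: le_trans FG; apply: ereal_sup_ubound.
exists (level f s), (level g t); split=> //.
by rewrite -cov_indic.
Qed.

End covariance_inequality.

Section observation.
Context {disp : measure_display} {T : measurableType disp} {R : realType}.
Variable P : probability T R.
Context {d : nat} (Y : int -> {RV P >-> d.-tuple R}).

(** The sigma-algebra [sigma_of Y I] as a measurable structure on [T]: measurability with respect to
    it is then obtained from the general lemmas on [measurable_fun]. *)
Definition observed (I : set int) : measurableType _ :=
  g_sigma_algebraType (\bigcup_(i in I) g_sigma_algebra_preimage (Y i)).

Lemma sigma_of_level (I : set int) (h : T -> R) t :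
  measurable_fun (T := observed I) setT h -> sigma_of Y I (level h t).
Proof. exact: (@measurable_level _ (observed I)). Qed.

Lemma measurable_observed (I : set int) i : I i ->
  measurable_fun (T := observed I) setT (Y i).
Proof.
move=> Ii _ B mB; apply: sub_sigma_algebra; exists i => //.
by exists B.
Qed.

End observation.

(** * Central limit theorem by blocks *)

Section elementary_bounds.
Context {R : realType}.
Implicit Types x y : R.

(** As the derivative is bounded only for |t| <= |x|, [M] may depend on [x]; iterating gives the
    Taylor bounds below, with constant 1 in place of inverse factorials. *)
Lemma mean_value_bound (f df : R -> R) x (M : R) :
  (forall t : R, is_derive t 1 f (df t)) ->
  (forall t, `|t| <= `|x| -> `|df t| <= M) -> `|f x - f 0| <= M * `|x|.
Proof.
move=> dfE dfM.
have cf a b : {within `[a, b], continuous f}.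
  apply: continuous_subspaceT => t.
  by apply/differentiable_continuous/derivable1_diffP; have [] := dfE t.
have [x0|x0] := leP x 0.
- have [t tx E] := MVT_segment x0 (fun t _ => dfE t) (@cf _ _).
  rewrite distrC E sub0r normrM normrN ler_wpM2r// dfM//.
  by move: tx; rewrite in_itv/= => /andP[? ?]; rewrite !ler0_norm ?lerN2.
- have [t tx ->] := MVT_segment (ltW x0) (fun t _ => dfE t) (@cf _ _).
  rewrite subr0 normrM ler_wpM2r// dfM//.
  by move: tx; rewrite in_itv/= => /andP[? ?]; rewrite !ger0_norm// ltW.
Qed.

Lemma sin_lip x : `|sin x| <= `|x|.
Proof.
have := @mean_value_bound sin cos x 1 (fun t => is_derive_sin t) (fun t _ => cos_max t).
by rewrite sin0 subr0 mul1r.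
Qed.

Lemma cos_lip x y : `|cos x - cos y| <= `|x - y|.
Proof.
have := @mean_value_bound (fun t => cos (y + t)) (fun t => - sin (y + t)) (x - y) 1.
rewrite addr0 subrKC mul1r; apply => [t|t _]; last by rewrite normrN sin_max.
have H : is_derive t 1 (fun t => y + t) 1.
  have := is_derive_affine y 1 t.
  by under eq_fun do rewrite mul1r.
have H' := @is_derive1_comp R cos _ t _ _ (is_derive_cos _) H.
by apply: (is_derive_eq H'); rewrite mulr1.
Qed.

Lemma oneBcos_le x : `|cos x - 1| <= x ^+ 2.
Proof.
have := @mean_value_bound cos (fun t => - sin t) x `|x| (fun t => is_derive_cos t).
rewrite cos0 -expr2 real_normK ?num_real//; apply => t tx.
by rewrite normrN (le_trans (sin_lip t)).
Qed.

Lemma sin_taylor x : `|sin x - x| <= `|x| ^+ 3.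
Proof.
have := @mean_value_bound (fun t => sin t - t) (fun t => cos t - 1) x (`|x| ^+ 2).
rewrite sin0 !subr0 -exprSr; apply => t tx; rewrite (le_trans (oneBcos_le t))// -[leLHS]real_normK ?num_real//.
by rewrite ler_sqr ?nnegrE.
Qed.

Lemma cos_taylor x : `|cos x - (1 - x ^+ 2 / 2)| <= `|x| ^+ 4.
Proof.
have := @mean_value_bound (fun t => cos t + 2^-1 * (t * t)) (fun t => t - sin t) x (`|x| ^+ 3).
rewrite cos0 !mulr0 addr0 -exprSr.
rewrite (_ : cos x + _ - 1 = cos x - (1 - x ^+ 2 / 2)); last by rewrite expr2; field.
apply => t.
  have H := is_derive_mul (is_derive_cst (2^-1 : R) t 1) (is_derive_mul (is_derive_id t 1) (is_derive_id t 1)).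
  have H' := is_deriveD (is_derive_cos t) H.
  by apply: (is_derive_eq H') => /=; field.
move=> tx; rewrite distrC (le_trans (sin_taylor t))//.
by rewrite ler_pXn2r ?nnegrE.
Qed.

Lemma expRN_taylor y : 0 <= y -> `|(1 - y) - expR (- y)| <= y ^+ 2.
Proof.
move=> y0; have h1 := expR_ge1Dx (- y).
rewrite ler0_norm; last by lra.
have y1 : 0 < 1 + y by lra.
have : expR (- y) <= (1 + y)^-1.
  by rewrite expRN lef_pV2 ?posrE ?expR_gt0// expR_ge1Dx.
move/le_trans => /(_ (1 - y + y ^+ 2)) h2.
suff : expR (- y) <= 1 - y + y ^+ 2 by lra.
apply: h2; rewrite -[leLHS]mul1r ler_pdivrMr//.
rewrite (_ : _ * _ = 1 + y ^+ 3); last by ring.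
by rewrite lerDl exprn_ge0.
Qed.

Lemma expRN_lip x y : 0 <= x -> 0 <= y -> `|expR (- x) - expR (- y)| <= `|x - y|.
Proof.
wlog xy : x y / x <= y.
  move=> H x0 y0; have [xy|/ltW yx] := leP x y; first exact: H.
  by rewrite distrC [leRHS]distrC; exact: H.
move=> x0 y0; rewrite ger0_norm; last by rewrite subr_ge0 ler_expR lerN2.
rewrite distrC ger0_norm ?subr_ge0//.
rewrite (_ : expR (- y) = expR (- x) * expR (- (y - x))); last first.
  by rewrite -expRD; congr expR; ring.
rewrite -[X in X - _]mulr1 -mulrBr.
have h1 := expR_ge1Dx (- (y - x)).
have h2 : expR (- x) <= 1 by rewrite -expR0 ler_expR oppr_le0.
have h3 : expR (- (y - x)) <= 1 by rewrite -expR0 ler_expR oppr_le0 subr_ge0.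
rewrite (@le_trans _ _ (1 - expR (- (y - x))))//; last by lra.
by rewrite ler_piMl// subr_ge0.
Qed.

End elementary_bounds.

(** * The block argument for a bounded centred sequence *)

Section blocks.
Context {disp : measure_display} {T : measurableType disp} {R : realType}.
Variables (P : probability T R) (x : nat -> T -> R) (B v K C : R).
Variable kappa : nat -> R.

Definition block s p w : R := \sum_(i < p) x (s + i) w.
(** An arbitrary selection of indices covers both the union of the blocks and all that is
    discarded. *)
Definition selected (sel : pred nat) n w : R := \sum_(i < n | sel i) x i w.

Hypothesis xm : forall i, measurable_fun setT (x i).
Hypothesis xB : forall i w, `|x i w| <= B.
Hypothesis x0 : forall i, mean P (x i) = 0.
Hypothesis v0 : 0 <= v.
Hypothesis K0 : 0 <= K.
Hypothesis C0 : 0 <= C.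
(** This bound and the next two are all that the argument retains of stationarity and mixing. *)
Hypothesis block_var : forall s p,
  `|mean P (fun w => block s p w ^+ 2) - p%:R * v| <= K.
Hypothesis selected_var : forall sel n,
  mean P (fun w => selected sel n w ^+ 2) <= C * \sum_(i < n) (sel i)%:R.
Hypothesis mixing : forall sel s q p a b l,
  `|cov P (fun w => cos (a + l * selected sel s w))
          (fun w => cos (b + l * block (s + q) p w))| <= kappa q.

Let bx i : bounded_mfun (x i). Proof. exact: bounded_mfun_le (xm i) (xB i). Qed.

Let B0 : 0 <= B.
Proof. by have := mean_cst P 0; rewrite (le_trans _ (xB 0 point)). Qed.

Let bblock s p : bounded_mfun (block s p).
Proof. exact: bounded_mfun_sum. Qed.

Let bselected sel n : bounded_mfun (selected sel n).
Proof.
rewrite /selected; under eq_fun do rewrite big_mkcond.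
apply: bounded_mfun_sum => i; case: (sel i) => //; exact: bounded_mfun_cst.
Qed.

Let block_le s p w : `|block s p w| <= p%:R * B.
Proof.
rewrite (le_trans (ler_norm_sum _ _ _))// (le_trans (ler_sum _ (fun i _ => xB _ _)))//.
by rewrite sumr_const card_ord mulr_natl.
Qed.

Let mean_block s p : mean P (block s p) = 0.
Proof. by rewrite mean_sum// big1. Qed.

Let bcos a l (f : T -> R) : bounded_mfun f -> bounded_mfun (fun w : T => cos (a + l * f w)).
Proof.
by move=> bf; apply: bounded_mfun_cos; apply: measurable_funD => //; apply: measurable_funM => //; exact: bf.1.
Qed.

Let bsin a l (f : T -> R) : bounded_mfun f -> bounded_mfun (fun w : T => sin (a + l * f w)).
Proof.
by move=> bf; apply: bounded_mfun_sin; apply: measurable_funD => //; apply: measurable_funM => //; exact: bf.1.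
Qed.

Let sinE a y : sin (a + y) = cos (a - pi / 2 + y) :> R.
Proof. by rewrite -cosBpihalf; congr cos; ring. Qed.

Let block_sq_le s p : mean P (fun w => block s p w ^+ 2) <= p%:R * v + K.
Proof. by have := block_var s p; rewrite ler_norml => /andP[_]; lra. Qed.

(* [2 * kappa q] pays for decoupling the block from the past; the rest bounds
   the distance from the characteristic function of the block at [l], which is
   expanded to second order, to that of N(0, p v). *)
Let step_error q p l : R :=
  2 * kappa q + (l ^+ 2 * K / 2 + (l ^+ 2 * (p%:R * v) / 2) ^+ 2 +
   (l * (p%:R * B) + (l * (p%:R * B)) ^+ 2) * (l ^+ 2 * (p%:R * v + K))).

(** By the addition formula the mean is E (U c) - E (V d). Decoupling costs [kappa q] twice; then E
    d is of third order because the block is centred, and E c is close to [rho] by a second-order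
    expansion and the block variance. *)
Let step sel s q p a l : 0 <= l ->
  `|mean P (fun w => cos (a + l * selected sel s w + l * block (s + q) p w)) -
    expR (- (l ^+ 2 * (p%:R * v) / 2)) * mean P (fun w => cos (a + l * selected sel s w))|
  <= step_error q p l.
Proof.
move=> l0; set b := block (s + q) p; set A := selected sel s.
set rho := expR _; set bd := l * (p%:R * B).
have bb : bounded_mfun b by exact: bblock.
have bA : bounded_mfun A by exact: bselected.
pose U w := cos (a + l * A w); pose V w := sin (a + l * A w).
pose c w := cos (0 + l * b w); pose d w := sin (0 + l * b w).
have [bU bV] : bounded_mfun U /\ bounded_mfun V by split; [exact: bcos|exact: bsin].
have [bc bd'] : bounded_mfun c /\ bounded_mfun d by split; [exact: bcos|exact: bsin].
have lb w : `|l * b w| <= bd by rewrite normrM (ger0_norm l0) ler_wpM2l//; exact: block_le.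
have bd0 : 0 <= bd by rewrite /bd; do 2 apply: mulr_ge0 => //.
have E1 : mean P (fun w => cos (a + l * A w + l * b w)) =
    cov P U c + mean P U * mean P c - (cov P V d + mean P V * mean P d).
  rewrite /cov !subrK -meanB; [|exact: bounded_mfunM|exact: bounded_mfunM].
  by congr mean; apply/funext => w; rewrite cosD /c /d !add0r.
have covUc : `|cov P U c| <= kappa q by exact: mixing.
(* A sine is a cosine with its phase shifted by pi / 2, and [mixing] allows every phase. *)
have covVd : `|cov P V d| <= kappa q.
  rewrite /V /d; under eq_fun do rewrite sinE.
  by under [X in cov _ _ X]eq_fun do rewrite sinE; exact: mixing.
pose m2 := l ^+ 2 * mean P (fun w => b w ^+ 2).
have bb2 : bounded_mfun (fun w => b w ^+ 2) by exact: bounded_mfunX.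
have m2E : m2 = mean P (fun w => l ^+ 2 * b w ^+ 2) by rewrite meanZ.
have m2le : m2 <= l ^+ 2 * (p%:R * v + K).
  by rewrite ler_wpM2l ?sqr_ge0//; exact: block_sq_le.
have m2v : `|m2 - l ^+ 2 * (p%:R * v)| <= l ^+ 2 * K.
  by rewrite -mulrBr normrM ger0_norm ?sqr_ge0// ler_wpM2l ?sqr_ge0//; exact: block_var.
have sinle : `|mean P d| <= bd * m2.
  have -> : mean P d = mean P (fun w => d w - l * b w).
    by rewrite meanB//; [rewrite meanZ// mean_block mulr0 subr0|exact: bounded_mfunZ].
  rewrite m2E -meanZ; last exact: bounded_mfunZ.
  apply: norm_mean_le => [||w].
  - by apply: bounded_mfunB => //; exact: bounded_mfunZ.
  - by do 2 apply: bounded_mfunZ.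
  - rewrite /d add0r (le_trans (sin_taylor _))// exprS -exprMn -[leRHS]/(_ * _).
    by rewrite -[X in _ <= _ * X]real_normK ?num_real// ler_wpM2r ?sqr_ge0.
have cosle : `|mean P c - (1 - m2 / 2)| <= bd ^+ 2 * m2.
  have -> : 1 - m2 / 2 = mean P (fun w => 1 - 2^-1 * (l ^+ 2 * b w ^+ 2)).
    rewrite meanB; [|exact: bounded_mfun_cst|by do 2 apply: bounded_mfunZ].
    by rewrite mean_cst meanZ -?m2E 1?mulrC//; exact: bounded_mfunZ.
  rewrite m2E -(@meanZ _ _ _ _ (bd ^+ 2)); last exact: bounded_mfunZ.
  apply: dist_mean => [|||w] //.
  - by apply: bounded_mfunB; [exact: bounded_mfun_cst|do 2 apply: bounded_mfunZ].
  - by do 2 apply: bounded_mfunZ.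
  - rewrite /c add0r -exprMn [2^-1 * _]mulrC (le_trans (cos_taylor _))//.
    rewrite (exprD _ 2 2) -[X in _ <= _ * X]real_normK ?num_real// ler_wpM2r ?sqr_ge0//.
    by rewrite ler_sqr ?nnegrE.
have rhole : `|1 - l ^+ 2 * (p%:R * v) / 2 - rho| <= (l ^+ 2 * (p%:R * v) / 2) ^+ 2.
  by apply: expRN_taylor; rewrite !mulr_ge0 ?sqr_ge0.
have U1 : `|mean P U| <= 1 by apply: norm_mean_le_cst => // w; exact: cos_max.
have V1 : `|mean P V| <= 1 by apply: norm_mean_le_cst => // w; exact: sin_max.
have crho : `|mean P c - rho| <= bd ^+ 2 * m2 + l ^+ 2 * K / 2 + (l ^+ 2 * (p%:R * v) / 2) ^+ 2.
  move: cosle m2v rhole; rewrite !ler_norml => /andP[? ?] /andP[? ?] /andP[? ?].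
  by apply/andP; split; lra.
have bdm2 : bd * m2 + bd ^+ 2 * m2 <= (bd + bd ^+ 2) * (l ^+ 2 * (p%:R * v + K)).
  by rewrite -mulrDl ler_wpM2l// addr_ge0// sqr_ge0.
rewrite E1 -/U (_ : _ - _ = cov P U c - cov P V d + mean P U * (mean P c - rho) -
  mean P V * mean P d); last by ring.
rewrite (le_trans (ler_normB _ _))// normrM.
have h1 : `|mean P V| * `|mean P d| <= bd * m2.
  by rewrite -[leRHS]mul1r ler_pM.
have h2 : `|mean P U * (mean P c - rho)| <= bd ^+ 2 * m2 + l ^+ 2 * K / 2 + (l ^+ 2 * (p%:R * v) / 2) ^+ 2.
  by rewrite normrM -[leRHS]mul1r ler_pM.
have h3 := ler_normD (cov P U c - cov P V d) (mean P U * (mean P c - rho)).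
have h4 := ler_normB (cov P U c) (cov P V d).
rewrite /step_error -/bd; lra.
Qed.

Section fixed_blocks.
Variables q p : nat.

(** Each period starts with its gap, so the block of period j is at distance q from everything
    before j (q + p), in the form that [mixing] expects. *)
Let sel (i : nat) := (q <= i %% (q + p))%N.

Let sum_selS (F : nat -> R) j : \sum_(i < j.+1 * (q + p) | sel i) F i =
  \sum_(i < j * (q + p) | sel i) F i + \sum_(i < p) F (j * (q + p) + q + i)%N.
Proof.
rewrite mulSnr big_split_ord/=; congr (_ + _).
transitivity (\sum_(i < q + p | (q <= i)%N) F (j * (q + p) + i)%N).
  apply: eq_bigl => i; rewrite /sel modnMDl modn_small//.
rewrite big_split_ord/= big_pred0 ?add0r; last first.
  by move=> i; apply/negbTE; rewrite -ltnNge.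
by apply: eq_big => [i|i _]; rewrite ?leq_addr// addnA.
Qed.

Let selected_count j : \sum_(i < j * (q + p)) (sel i)%:R = (j * p)%:R :> R.
Proof.
transitivity (\sum_(i < j * (q + p) | sel i) (1 : R)).
  by rewrite [RHS]big_mkcond; apply: eq_bigr => i _; case: (sel i).
elim: j => [|j IH]; first by rewrite !mul0n big_ord0.
by rewrite (sum_selS (fun=> 1)) IH sumr_const card_ord mulSnr natrD.
Qed.

Let block_chain a l j : 0 <= l ->
  `|mean P (fun w => cos (a + l * selected sel (j * (q + p)) w)) -
    expR (- (l ^+ 2 * (p%:R * v) / 2)) ^+ j * cos a| <= j%:R * step_error q p l.
Proof.
move=> l0; set rho := expR _; elim: j => [|j IH].
  rewrite mul0r expr0 mul1r /selected.
  by under eq_fun do rewrite mul0n big_ord0 mulr0 addr0; rewrite mean_cst subrr normr0.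
have := step sel (j * (q + p)) q p a l0.
set A := mean P _ in IH *; rewrite -/rho => Hstep.
have -> : mean P (fun w => cos (a + l * selected sel (j.+1 * (q + p)) w)) =
  mean P (fun w => cos (a + l * selected sel (j * (q + p)) w +
    l * block (j * (q + p) + q) p w)).
  congr mean; apply/funext => w; rewrite -addrA -mulrDr; congr (cos (a + l * _)).
  exact: (sum_selS (x ^~ w)).
have rho01 : 0 <= rho <= 1.
  rewrite expR_ge0/= -expR0 ler_expR oppr_le0 divr_ge0// mulr_ge0 ?sqr_ge0//.
  exact: mulr_ge0.
have rhoA : `|rho * A - rho ^+ j.+1 * cos a| <= j%:R * step_error q p l.
  case/andP: rho01 => r0 r1.
  rewrite exprS -mulrA -mulrBr normrM ger0_norm// (le_trans _ IH)//.
  by rewrite ler_piMl.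
rewrite -natr1 mulrDl mul1r [leRHS]addrC.
apply: le_trans (lerD Hstep rhoA); apply: le_trans (ler_normD _ _).
by rewrite le_eqVlt; apply/orP; left; apply/eqP; congr `|_|; ring.
Qed.

(** With D the discarded sum, the cosines differ by at most |l D| <= eta + (l D)^2 / eta, so the
    second moment of D suffices; [selected_var] bounds it by [C] times the number of discarded
    indices. *)
Let remainder a l n eta : (0 < q + p)%N -> 0 <= l -> 0 < eta ->
  `|mean P (fun w => cos (a + l * block 0 n w)) -
    mean P (fun w => cos (a + l * selected sel (n %/ (q + p) * (q + p)) w))|
  <= eta + l ^+ 2 * C / eta * (n%:R - (n %/ (q + p) * p)%:R).
Proof.
move=> qp0 l0 eta0; set k := (n %/ (q + p))%N.
have kn : (k * (q + p) <= n)%N by exact: leq_divM.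
pose sel' i := ~~ (sel i && (i < k * (q + p))%N).
have SE w : block 0 n w = selected sel (k * (q + p)) w + selected sel' n w.
  rewrite /block /selected (big_ord_widen_cond n sel (x ^~ w) kn).
  by rewrite (bigID (fun i : 'I_n => sel i && (i < k * (q + p))%N)).
have cnt : \sum_(i < n) (sel' i)%:R = n%:R - (k * p)%:R :> R.
  rewrite -selected_count; apply/eqP; rewrite eq_sym subr_eq; apply/eqP.
  have -> : \sum_(i < k * (q + p)) (sel i)%:R =
      \sum_(i < n) (sel i && (i < k * (q + p))%N)%:R :> R.
    rewrite (big_ord_widen n (fun i => (sel i)%:R : R) kn) big_mkcond/=.
    by apply: eq_bigr => i _; case: ltnP; rewrite ?andbT ?andbF.
  rewrite -big_split/= -[LHS]mulr_natl mulr1.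
  transitivity (\sum_(i < n) (1 : R)); first by rewrite sumr_const card_ord.
  by apply: eq_bigr => i _; rewrite /sel'; case: (_ && _); rewrite ?addr0 ?add0r.
have bD := bselected sel' n.
apply: (@le_trans _ _ (mean P (fun w => eta + l ^+ 2 / eta * selected sel' n w ^+ 2))).
  apply: dist_mean => [|||w].
  - by apply: bcos.
  - by apply: bcos.
  - apply: bounded_mfunD; first exact: bounded_mfun_cst.
    by apply: bounded_mfunZ; exact: bounded_mfunX.
  - rewrite (le_trans (cos_lip _ _))// SE.
    rewrite (_ : _ - _ = l * selected sel' n w); last by ring.
    set D := selected sel' n w.
    rewrite [l ^+ 2 / eta * _]mulrAC -exprMn.
    have h := sqr_ge0 (`|l * D| - eta).
    rewrite -lerBlDl ler_pdivlMr// -[X in _ <= X]real_normK ?num_real//.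
    by have h2 := sqr_ge0 (`|l * D|); rewrite !expr2 in h h2 *; nra.
rewrite meanD; [|exact: bounded_mfun_cst|by apply: bounded_mfunZ; exact: bounded_mfunX].
rewrite mean_cst meanZ; last exact: bounded_mfunX.
rewrite lerD2l [l ^+ 2 * C / eta]mulrAC -[leRHS]mulrA ler_wpM2l//.
  by rewrite divr_ge0 ?sqr_ge0// ltW.
by rewrite -cnt; exact: selected_var.
Qed.

(** [r] bounds the proportion of indices outside the blocks: q / p for the gaps, (q + p) / n for the
    incomplete last period. It governs the discarded sum and also the variance lacking in the
    product of the block factors. *)
Lemma clt_bound a n eta : (0 < p)%N -> (0 < n)%N -> 0 < eta ->
  let l := (Num.sqrt n%:R)^-1 in let r := q%:R / p%:R + (q + p)%:R / n%:R in
  `|mean P (fun w => cos (a + l * block 0 n w)) - expR (- (v / 2)) * cos a| <=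
  n%:R / p%:R * step_error q p l + eta + (C / eta + v / 2) * r.
Proof.
move=> p0 n0 eta0 /=; set l := (Num.sqrt _)^-1.
set r := q%:R / p%:R + _; set k := (n %/ (q + p))%N.
have nR : 0 < n%:R :> R by rewrite ltr0n.
have pR : 0 < p%:R :> R by rewrite ltr0n.
have l0 : 0 <= l by rewrite invr_ge0 sqrtr_ge0.
have l2 : l ^+ 2 = n%:R^-1 by rewrite exprVn sqr_sqrtr// ltW.
have qp0 : (0 < q + p)%N by rewrite addn_gt0 p0 orbT.
have kapn : (k * p <= n)%N.
  by rewrite (leq_trans _ (leq_divM n (q + p)))// leq_mul2l leq_addl orbT.
have kn : k%:R <= n%:R / p%:R :> R by rewrite ler_pdivlMr// -natrM ler_nat.
have gap : (n%:R - (k * p)%:R) / n%:R <= r.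
  rewrite /r ler_pdivrMr// mulrDl divfK ?gt_eqF// lerBlDr.
  rewrite {1}(divn_eq n (q + p)) -/k mulnDr !natrD !natrM.
  have h : k%:R * q%:R <= q%:R / p%:R * n%:R :> R.
    by rewrite [leRHS]mulrAC -[leRHS]mulrA [leLHS]mulrC ler_wpM2l.
  have h' : (n %% (q + p))%:R <= q%:R + p%:R :> R.
    by rewrite -natrD ler_nat ltnW// ltn_pmod.
  lra.
have h1 := block_chain a k l0.
have h2 := remainder a n qp0 l0 eta0.
have se0 : 0 <= step_error q p l.
  by have := block_chain a 1 l0; rewrite mul1r; exact: le_trans.
rewrite -/k in h1 h2.
set rho := expR _ in h1.
have h3 : `|rho ^+ k * cos a - expR (- (v / 2)) * cos a| <= v / 2 * r.
  rewrite -mulrBl normrM -expRM_natl (le_trans (ler_piMr _ (cos_max a)))//.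
  rewrite mulrN (le_trans (expRN_lip _ _)) ?divr_ge0 ?mulr_ge0 ?sqr_ge0//.
  rewrite l2 (_ : k%:R * (n%:R^-1 * (p%:R * v) / 2) - v / 2 =
    - (v / 2 * ((n%:R - (k * p)%:R) / n%:R))); last first.
    by rewrite natrM; field; rewrite gt_eqF.
  rewrite normrN ger0_norm; first by rewrite ler_wpM2l// divr_ge0.
  by rewrite !mulr_ge0// ?invr_ge0// subr_ge0 ler_nat.
have h2' : l ^+ 2 * C / eta * (n%:R - (k * p)%:R) <= C / eta * r.
  rewrite l2 [leLHS](_ : _ = C / eta * ((n%:R - (k * p)%:R) / n%:R)); last by ring.
  by rewrite ler_wpM2l// divr_ge0// ltW.
have h1' : k%:R * step_error q p l <= n%:R / p%:R * step_error q p l.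
  by rewrite ler_wpM2r.
rewrite (mulrDl (C / eta)).
move: h1 h2 h3; rewrite !ler_norml => /andP[? ?] /andP[? ?] /andP[? ?].
by apply/andP; split; lra.
Qed.

End fixed_blocks.

Lemma block_clt K2 a : 0 <= K2 ->
  (forall q, (0 < q)%N -> kappa q <= K2 / q%:R ^+ 2) ->
  mean P (fun w => cos (a + (Num.sqrt n%:R)^-1 * block 0 n w)) @[n --> \oo] -->
  expR (- (v / 2)) * cos a.
Proof.
move=> K20 kappaK2; apply/cvgrPdist_le => e e0.
pose eta := e / 4; have eta0 : 0 < eta by rewrite divr_gt0.
pose D := C / eta + v / 2.
have D0 : 0 <= D by rewrite addr_ge0// divr_ge0// ltW.
(* [M] takes care of the terms that do not vanish with n for fixed [M], namely those of third order
   and the gaps; all others are O(1 / sqrt n) and their coefficients are collected in [E]. *)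
have [M M0 HM] := natr_large (B * (1 + B) * v + D) eta0.
pose E := 16 * K2 * M%:R ^+ 5 + K * M%:R + v ^+ 2 + 2 * B * (1 + B) * K + 2 * D.
have [N N0 HN] := natr_large E eta0.
have MR : 1 <= M%:R :> R by rewrite ler1n.
have M0' : 0 < M%:R :> R by rewrite ltr0n.
near=> n.
have n0 : (0 < n)%N by near: n; exact: nbhs_infty_gt.
pose y : R := Num.sqrt n%:R.
have y2 : y ^+ 2 = n%:R by rewrite sqr_sqrtr.
have y0 : 0 < y by rewrite sqrtr_gt0 ltr0n.
have large (m : nat) : (m ^ 2 <= n)%N -> m%:R <= y.
  by move=> mn; rewrite -ler_sqr ?nnegrE ?(ltW y0)// y2 -natrX ler_nat.
(* Hence y / M^2 >= 2, and truncating it to the integer [q] loses at most half of it. *)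
have yM : 2 * M%:R ^+ 2 <= y.
  rewrite -natrX -natrM; apply: large; near: n; exact: nbhs_infty_ge.
have yN : N%:R <= y by apply: large; near: n; exact: nbhs_infty_ge.
(* With q of order sqrt n / M^2 and p = M q: the gaps are a fraction 1/M of the
   whole, the third-order terms add up to O(p / sqrt n) = O(1/M), and the
   n / p decoupling errors, O(q^-2) each, add up to O(M^5 / sqrt n). *)
pose q := Num.truncn (y / M%:R ^+ 2); pose p := (M * q)%N.
have MM0 : 0 < M%:R ^+ 2 :> R by rewrite exprn_gt0.
have /andP[qle qgt] : q%:R <= y / M%:R ^+ 2 < q.+1%:R.
  by apply: truncn_itv; rewrite divr_ge0// ltW.
have qge : y / M%:R ^+ 2 / 2 <= q%:R.
  have : 2 <= y / M%:R ^+ 2 by rewrite ler_pdivlMr.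
  by rewrite -natr1 in qgt; lra.
have q0 : 0 < q%:R :> R by apply: lt_le_trans qge; rewrite !divr_gt0.
have pE : p%:R = M%:R * q%:R :> R by rewrite natrM.
have p0 : 0 < p%:R :> R by rewrite pE mulr_gt0.
have ply : p%:R * M%:R <= y.
  by move: qle; rewrite ler_pdivlMr// pE mulrAC -expr2 mulrC.
have yp : y <= 2 * M%:R * p%:R.
  by move: qge; rewrite ler_pdivrMr// ler_pdivrMr// pE; rewrite !expr2; nra.
have := @clt_bound q p a n eta; rewrite -!(ltr0n R) p0 ltr0n n0 => /(_ isT isT eta0) /=.
rewrite -/y -y2 distrC => /le_trans; apply.
have invp : p%:R^-1 <= 2 * M%:R / y.
  by rewrite ler_pdivlMr// mulrC ler_pdivrMr.
have pMy : p%:R / y <= M%:R^-1 by rewrite ler_pdivrMr// mulrC ler_pdivlMr.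
have kq : kappa q <= 4 * M%:R ^+ 4 * K2 / y ^+ 2.
  rewrite (le_trans (kappaK2 q _))//; first by rewrite -(ltr0n R).
  rewrite [leRHS](_ : _ = K2 * (2 * M%:R ^+ 2 / y) ^+ 2); last by field; rewrite gt_eqF.
  rewrite -exprVn ler_wpM2l// ler_sqr ?nnegrE ?invr_ge0 ?divr_ge0 ?mulr_ge0 ?(ltW q0) ?(ltW y0) ?(ltW MM0)//.
  rewrite ler_pdivlMr// mulrC ler_pdivrMr//.
  by move: qge; rewrite ler_pdivrMr// ler_pdivrMr//; lra.
have kq0 : 0 <= kappa q by exact: le_trans (normr_ge0 _) (mixing xpred0 0 q 0 0 0 0).
have My : p%:R / y <= 1 by rewrite (le_trans pMy)// invf_le1.
have t1 : 2 * kappa q * y ^+ 2 / p%:R <= 16 * K2 * M%:R ^+ 5 / y.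
  rewrite [leRHS](_ : _ = 2 * (4 * M%:R ^+ 4 * K2 / y ^+ 2) * y ^+ 2 * (2 * M%:R / y)); last first.
    by field; rewrite gt_eqF.
  apply: ler_pM => //; rewrite ?invr_ge0 ?(ltW p0)//.
    by rewrite mulr_ge0 ?sqr_ge0 ?mulr_ge0.
  by rewrite ler_wpM2r ?sqr_ge0// ler_wpM2l.
have t2 : K / (2 * p%:R) <= K * M%:R / y.
  rewrite invfM mulrA [leRHS](_ : _ = K / 2 * (2 * M%:R / y)); last first.
    by field; rewrite gt_eqF.
  by rewrite ler_wpM2l// divr_ge0.
have t3 : p%:R * v ^+ 2 / (4 * y ^+ 2) <= v ^+ 2 / y.
  rewrite [leLHS](_ : _ = p%:R / y * (v ^+ 2 / (4 * y))); last first.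
    by field; rewrite gt_eqF.
  rewrite (@le_trans _ _ (v ^+ 2 / (4 * y)))//.
    by rewrite ler_piMl// divr_ge0 ?sqr_ge0 ?mulr_ge0// ltW.
  rewrite ler_wpM2l ?sqr_ge0// lef_pV2 ?posrE ?mulr_gt0//.
  by rewrite ler_peMl ?ler1n// ltW.
have t4 : (p%:R * B / y + (p%:R * B / y) ^+ 2) * (v + K / p%:R) <=
    B * (1 + B) * v / M%:R + 2 * B * (1 + B) * K / y.
  rewrite [leRHS](_ : _ = M%:R^-1 * B * (1 + B) * (v + K * (2 * M%:R / y))); last first.
    by field; rewrite !gt_eqF.
  rewrite [p%:R * B / y]mulrAC.
  set c := p%:R / y in pMy My *; have c0 : 0 <= c by rewrite divr_ge0 ?ltW.
  apply: ler_pM; rewrite ?addr_ge0 ?sqr_ge0 ?mulr_ge0 ?invr_ge0 ?(ltW p0) ?(ltW y0)//.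
    rewrite (_ : c * B + (c * B) ^+ 2 = c * B * (1 + c * B)); last by ring.
    apply: ler_pM.
    - by rewrite mulr_ge0.
    - by rewrite addr_ge0// mulr_ge0.
    - by rewrite ler_wpM2r.
    - by rewrite lerD2l ler_piMl.
  by rewrite lerD2l ler_wpM2l.
have t5 : D * (q%:R / p%:R + (q + p)%:R / y ^+ 2) <= D / M%:R + 2 * D / y.
  rewrite [leRHS](_ : _ = D * (M%:R^-1 + 2 / y)); last by field; rewrite !gt_eqF.
  rewrite ler_wpM2l// lerD//.
    by rewrite pE invfM mulrCA divff ?mulr1// gt_eqF.
  rewrite ler_pdivrMr ?exprn_gt0// expr2 mulrA divfK ?gt_eqF// natrD.
  have : q%:R <= p%:R :> R by rewrite pE ler_peMl// ltW.
  by move: My; rewrite ler_pdivrMr// mul1r; lra.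
have sE : y ^+ 2 / p%:R * step_error q p y^-1 = 2 * kappa q * y ^+ 2 / p%:R +
    K / (2 * p%:R) + p%:R * v ^+ 2 / (4 * y ^+ 2) +
    (p%:R * B / y + (p%:R * B / y) ^+ 2) * (v + K / p%:R).
  by rewrite /step_error; field; rewrite !gt_eqF.
have HN' : E / y <= eta.
  rewrite (le_trans _ HN)// ler_wpM2l//; last by rewrite lef_pV2 ?posrE// ltr0n.
  by rewrite /E !addr_ge0// !mulr_ge0// ?exprn_ge0 ?addr_ge0 ?(ltW M0') ?sqr_ge0.
have EE : E / y = 16 * K2 * M%:R ^+ 5 / y + K * M%:R / y + v ^+ 2 / y +
    2 * B * (1 + B) * K / y + 2 * D / y by rewrite /E; ring.
rewrite sE -/D.
move: HM HN'; rewrite mulrDl EE => HM HN'.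
rewrite (_ : e = 4 * eta); last by rewrite /eta; field.
move: t1 t2 t3 t4 t5 HM HN'.
set u1 := 16 * K2 * _ / y; set u2 := K * _ / y; set u3 := v ^+ 2 / y.
set u4 := 2 * B * _ * _ / y; set u5 := 2 * D / y; set u6 := _ * v / M%:R.
set u7 := D / M%:R; lra.
Unshelve. all: by end_near. Qed.

End blocks.

(** * Stationary mixing sequences *)

Section integer_sums.
Context {R : realType}.
Implicit Types (a f : int -> \bar R) (h : nat -> \bar R).

Lemma esum_int f : (forall i, (0 <= f i)%E) ->
  (\esum_(i in [set: int]) f i =
   \esum_(n in [set: nat]) f (Posz n) + \esum_(n in [set: nat]) f (Negz n))%E.
Proof.
move=> f0; rewrite (esumID (range Posz))//.
rewrite !setTI; congr (_ + _)%E.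
  by rewrite esum_image// => m n _ _ [].
rewrite (_ : ~` range Posz = range Negz).
  by rewrite esum_image// => m n _ _ [].
apply/seteqP; split => [[n|n] /= H|_ [n _ <-] [m _]//]; last by exists n.
by exfalso; apply: H; exists n.
Qed.

Lemma summable_nat_cvg h : summable [set: nat] h ->
  \sum_(n < N) fine (h n) @[N --> \oo] -->
  fine (\esum_(n in [set: nat]) (h^\+)%E n - \esum_(n in [set: nat]) (h^\-)%E n)%E.
Proof.
have ge0_cvg k : (forall n : nat, 0 <= k n)%E -> summable [set: nat] k ->
    \sum_(n < N) fine (k n) @[N --> \oo] --> fine (\esum_(n in [set: nat]) k n).
  move=> k0 sk; rewrite -nneseries_esumT//.
  have sk' : summable [set i | xpredT i] k by move: sk; rewrite -set_true.
  rewrite (summable_nneseries_lim (fun i _ => k0 i) sk')/=.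
  have := summable_cvg (fun i _ => k0 i) sk'.
  by under eq_cvg do rewrite big_mkord.
move=> sh; have sp := summable_funepos sh; have sn := summable_funeneg sh.
have p0 n : (0 <= h^\+ n)%E by exact: funepos_ge0.
have n0 n : (0 <= h^\- n)%E by exact: funeneg_ge0.
rewrite fineB; last 2 first.
- by have := sp; rewrite summableE; under eq_esum do rewrite gee0_abs//.
- by have := sn; rewrite summableE; under eq_esum do rewrite gee0_abs//.
have -> : (fun N => \sum_(n < N) fine (h n)) = (fun N => \sum_(n < N) fine ((h^\+)%E n) -
    \sum_(n < N) fine ((h^\-)%E n)).
  apply/funext => N; rewrite -sumrB; apply: eq_bigr => n _.
  have := summable_pinfty sh (I : [set: nat] n); rewrite funeposE funenegE.
  case: (h n) => [r||]//= _; rewrite -!EFin_max/=.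
  by rewrite !maxEle; case: ifP; case: ifP => /=; lra.
by apply: cvgB; exact: ge0_cvg.
Qed.

(** As [Negz n] is - (n + 1), the unequal ranges make up the symmetric one |r| <= N. *)
Lemma sum_int_cvg a : summable [set: int] a ->
  \sum_(n < N.+1) fine (a n) + \sum_(n < N) fine (a (Negz n)) @[N --> \oo] -->
  sum_int a.
Proof.
move=> sa.
have [sP sN] : summable [set: nat] (a \o Posz) /\ summable [set: nat] (a \o Negz).
  move: sa; rewrite /summable esum_int// => sa; split; apply: le_lt_trans sa.
    by rewrite leeDl// esum_ge0.
  by rewrite leeDr// esum_ge0.
have fin h : summable [set: nat] h -> (\esum_(n in [set: nat]) (h^\+)%E n)%E \is a fin_num /\
    (\esum_(n in [set: nat]) (h^\-)%E n)%E \is a fin_num.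
  move=> sh; split.
    by have := summable_funepos sh; rewrite summableE; under eq_esum do rewrite gee0_abs//.
  by have := summable_funeneg sh; rewrite summableE; under eq_esum do rewrite gee0_abs//.
have [p1 m1] := fin _ sP; have [p2 m2] := fin _ sN.
have -> : sum_int a =
    fine (\esum_(n in [set: nat]) ((a \o Posz)^\+)%E n - \esum_(n in [set: nat]) ((a \o Posz)^\-)%E n)%E +
    fine (\esum_(n in [set: nat]) ((a \o Negz)^\+)%E n - \esum_(n in [set: nat]) ((a \o Negz)^\-)%E n)%E.
  have pE (c : nat -> int) : (fun n => (a^\+)%E (c n)) = ((a \o c)^\+)%E.
    by apply/funext => n; rewrite !funeposE.
  have mE (c : nat -> int) : (fun n => (a^\-)%E (c n)) = ((a \o c)^\-)%E.
    by apply/funext => n; rewrite !funenegE.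
  rewrite /sum_int (@esum_int (a^\+)%E)// (@esum_int (a^\-)%E)// !pE !mE.
  rewrite (fineB p1 m1) (fineB p2 m2) fineB ?fin_numD ?p1 ?p2 ?m1 ?m2//.
  rewrite (fineD p1 p2) (fineD m1 m2).
  by ring.
apply: cvgD; last exact: summable_nat_cvg.
rewrite (cvg_shiftS (fun N => \sum_(n < N) fine (a n))).
exact: summable_nat_cvg.
Qed.

End integer_sums.

(** * Corner functions under the uniform law *)

Section corner_functions.
Context {R : realType} {d : nat}.
Implicit Types (c : 'I_d -> bool) (p : d.-tuple R).

Lemma cornerLe_rectangle c p : unit_cube p ->
  cornerLe c p = [set s | forall k,
    (if c k then `[tnth p k, 1] else `[0, tnth p k])%classic (tnth s k)].
Proof.
move=> p01; apply/seteqP; split => [s [s01 cs] k|s cs].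
  by have := cs k; have := s01 k; case: (c k) => /=; rewrite in_itv/= => /andP[? ?] ?; apply/andP.
split=> k; have := cs k; have := p01 k; case: (c k) => /=; rewrite in_itv/= => /andP[p0 p1] /andP[s0 s1] //.
  by rewrite s1 (le_trans p0).
by rewrite s0 (le_trans s1).
Qed.

Lemma measurable_cornerLe c p : unit_cube p -> measurable (cornerLe c p).
Proof.
move=> p01; rewrite cornerLe_rectangle//.
have -> : [set s : d.-tuple R | forall k,
    (if c k then `[tnth p k, 1] else `[0, tnth p k])%classic (tnth s k)] =
  \bigcap_(k in [set: 'I_d]) ((@tnth d R)^~ k @^-1` (if c k then `[tnth p k, 1] else `[0, tnth p k])%classic).
  by apply/seteqP; split => s H k; [move=> _; exact: H|exact: H].
apply: fin_bigcap_measurable => [|k _]; first exact: finite_finset.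
rewrite -[X in measurable X]setTI; apply: measurable_tnth => //.
by case: (c k).
Qed.

Lemma uniform_prob_itv (a b : R) : 0 <= a -> a <= b -> b <= 1 ->
  uniform_prob (@ltr01 R) `[a, b]%classic = (b - a)%:E.
Proof.
move=> a0 ab b1; rewrite /uniform_prob.
rewrite (eq_integral (cst 1%:E)); last first.
  move=> x; rewrite inE/= in_itv/= => /andP[ax xb].
  by rewrite /uniform_pdf (le_trans a0 ax) (le_trans xb b1)/= subr0 invr1.
rewrite integral_cst//= mul1e lebesgue_measure_itv/= lte_fin.
by case: ltgtP ab => // ->; rewrite subrr.
Qed.

Lemma cornerF01 c p : unit_cube p -> 0 <= cornerF c p <= 1.
Proof.
move=> p01; rewrite /cornerF.
have H k : 0 <= (if c k then 1 - tnth p k else tnth p k) <= 1.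
  by have /andP[? ?] := p01 k; case: (c k); apply/andP; split; lra.
by rewrite prodr_ge0/= ?prodr_ile1// => k _; have /andP[] := H k.
Qed.

Lemma measurable_xi c p : unit_cube p -> measurable_fun setT (xi c p).
Proof.
move=> p01; apply: measurable_funB; last exact: measurable_cst.
by apply: measurable_indic; exact: measurable_cornerLe.
Qed.

Lemma xi_le1 c p y : unit_cube p -> `|xi c p y| <= 1.
Proof.
move=> /(cornerF01 c)/andP[F0 F1]; rewrite /xi indicE.
by case: (_ \in _) => /=; rewrite ler_norml; apply/andP; split; lra.
Qed.

Context {disp : measure_display} {T : measurableType disp}.
Variable P : probability T R.

Lemma probability_cornerLe (X : {RV P >-> d.-tuple R}) c p : uniform_on_cube X ->
  unit_cube p -> P (X @^-1` cornerLe c p) = (cornerF c p)%:E.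
Proof.
move=> uX p01; rewrite cornerLe_rectangle//.
rewrite [LHS](uX (fun k => (if c k then `[tnth p k, 1] else `[0, tnth p k])%classic)); last first.
  by move=> k; case: (c k).
rewrite /cornerF -prodEFin; apply: eq_bigr => k _.
have /andP[p0 p1] := p01 k.
by case: (c k); rewrite uniform_prob_itv// subr0.
Qed.

Lemma bounded_mfun_xi (X : {RV P >-> d.-tuple R}) c p : unit_cube p ->
  bounded_mfun (fun w => xi c p (X w)).
Proof.
move=> p01; apply: (@bounded_mfun_le _ _ _ _ 1) => [|w]; last exact: xi_le1.
exact: measurableT_comp (measurable_xi c p01) _.
Qed.

Lemma xi_indic (X : {RV P >-> d.-tuple R}) c p :
  (fun w => xi c p (X w)) = (fun w => \1_(X @^-1` cornerLe c p) w - cornerF c p).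
Proof. by apply/funext => w; rewrite /xi !indicE. Qed.

Lemma mean_xi (X : {RV P >-> d.-tuple R}) c p : uniform_on_cube X ->
  unit_cube p -> mean P (fun w => xi c p (X w)) = 0.
Proof.
move=> uX p01; have mA : measurable (X @^-1` cornerLe c p).
  by rewrite -[X in measurable X]setTI; apply: measurable_funP => //; exact: measurable_cornerLe.
rewrite xi_indic meanB; [|exact: bounded_mfun_indic|exact: bounded_mfun_cst].
by rewrite mean_indic// probability_cornerLe//= mean_cst subrr.
Qed.

End corner_functions.

(** * Covariances of a stationary mixing sequence *)

Section stationary_mixing.
Context {R : realType} {disp : measure_display} {T : measurableType disp}.
Variables (P : probability T R) (d : nat) (Y : int -> {RV P >-> d.-tuple R}).
Variable phi : nat -> R.
Hypothesis statY : strictly_stationary Y.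
Hypothesis uniformY : forall i, uniform_on_cube (Y i).
Hypothesis phi_ge0 : forall r, 0 <= phi r.
Hypothesis alphaY : forall r, (1 <= r)%N -> (alpha_mixing Y r <= (phi r)%:E)%E.
Hypothesis summable_phi : (\sum_(0 <= r <oo) (r%:R * phi r)%:E < +oo)%E.

Let Phi : R := fine (\sum_(0 <= r <oo) (r%:R * phi r)%:E)%E.

Let rphi_ge0 r : (0 <= (r%:R * phi r)%:E)%E.
Proof. by rewrite lee_fin mulr_ge0. Qed.

Let sum_rphi N : \sum_(r < N) r%:R * phi r <= Phi.
Proof.
have Phi_fin : (\sum_(0 <= r <oo) (r%:R * phi r)%:E)%E \is a fin_num.
  by rewrite ge0_fin_numE//; exact: nneseries_ge0.
rewrite -lee_fin fineK// -sumEFin -(big_mkord xpredT (fun r => (r%:R * phi r)%:E)).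
by apply: nneseries_lim_ge => r _ _; exact: rphi_ge0.
Qed.

Let Phi_ge0 : 0 <= Phi.
Proof. by have := sum_rphi 0; rewrite big_ord0. Qed.

Let sum_phi N : \sum_(r < N) phi r.+1 <= Phi.
Proof.
apply: le_trans (sum_rphi N.+1); rewrite [leRHS]big_ord_recl mul0r add0r.
by apply: ler_sum => r _; rewrite ler_peMl// ler1n.
Qed.

Let measurable_of_observed I (h : T -> R) :
  measurable_fun (T := observed Y I) setT h -> measurable_fun setT h.
Proof.
move=> mh _ B mB; have := mh measurableT B mB; rewrite !setTI.
apply: smallest_sub; first exact: sigma_algebra_measurable.
move=> A [i _ [C mC <-]]; rewrite setTI.
by rewrite -[X in measurable X]setTI; exact: measurable_funP.
Qed.

Lemma mixing_cov (k : int) r (f g : T -> R) : (1 <= r)%N ->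
  measurable_fun (T := observed Y [set i | i <= k]) setT f ->
  measurable_fun (T := observed Y [set i | k + r%:Z <= i]) setT g ->
  (forall w, `|f w| <= 1) -> (forall w, `|g w| <= 1) ->
  `|cov P f g| <= 4 * phi r.
Proof.
move=> r1 mf mg f1 g1.
apply: (@alpha_sets_cov _ _ _ P (sigma_of Y [set i | i <= k])
  (sigma_of Y [set i | k + r%:Z <= i])) => //.
- by apply: le_trans (alphaY r1); apply: ereal_sup_ubound; exists k.
- exact: measurable_of_observed mf.
- exact: measurable_of_observed mg.
- by move=> t; exact: sigma_of_level.
- by move=> t; exact: sigma_of_level.
Qed.

(* Every index r <= q yields the bound 4 phi r; averaging these bounds with the
   weights r makes up for phi not being monotone. *)
Let mixing_cov_sqr (k : int) q (f g : T -> R) : (0 < q)%N ->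
  measurable_fun (T := observed Y [set i | i <= k]) setT f ->
  measurable_fun (T := observed Y [set i | k + q%:Z <= i]) setT g ->
  (forall w, `|f w| <= 1) -> (forall w, `|g w| <= 1) ->
  `|cov P f g| <= 8 * Phi / q%:R ^+ 2.
Proof.
move=> q0 mf mg f1 g1; rewrite ler_pdivlMr ?exprn_gt0 ?ltr0n//.
have H r : (1 <= r <= q)%N -> `|cov P f g| <= 4 * phi r.
  move=> /andP[r1 rq]; apply: mixing_cov r1 mf _ f1 g1.
  have sub : [set i | k + q%:Z <= i] `<=` [set i | k + r%:Z <= i].
    by move=> i /=; apply: le_trans; rewrite lerD2l lez_nat.
  move=> _ B mB; apply: sub_sigma_algebra2 (mg measurableT B mB).
  by apply: bigcup_subset; exact: sub.
have : \sum_(r < q.+1) r%:R * `|cov P f g| <= 4 * Phi.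
  apply: (@le_trans _ _ (4 * \sum_(r < q.+1) r%:R * phi r)); last by rewrite ler_wpM2l.
  rewrite mulr_sumr; apply: ler_sum => -[[|r] rq] _ /=; first by rewrite !mul0r mulr0.
  by rewrite mulrCA ler_wpM2l// H.
(* The total weight is at least q^2 / 2, which turns 4 Phi into 8 Phi / q^2. *)
have S n : \sum_(r < n.+1) r%:R = n%:R * (n%:R + 1) / 2 :> R.
  elim: n => [|n IH]; first by rewrite big_ord1 mul0r mul0r.
  by rewrite big_ord_recr/= IH -[n.+1%:R]natr1; field.
rewrite -mulr_suml S => h.
have := normr_ge0 (cov P f g); have : 0 < q%:R :> R by rewrite ltr0n.
set c := `|_| in h *; set x := q%:R in h *; rewrite expr2; nra.
Qed.

Section pairs.
Variables (c1 c2 : 'I_d -> bool) (p1 p2 : d.-tuple R).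
Hypotheses (p1I : unit_cube p1) (p2I : unit_cube p2).

Definition gamma i j : R := mean P (fun w => xi c1 p1 (Y i w) * xi c2 p2 (Y j w)).

Let mC1 : measurable (cornerLe c1 p1). Proof. exact: measurable_cornerLe. Qed.
Let mC2 : measurable (cornerLe c2 p2). Proof. exact: measurable_cornerLe. Qed.

Let mY i (A : set (d.-tuple R)) : measurable A -> measurable (Y i @^-1` A).
Proof. by move=> mA; rewrite -[X in measurable X]setTI; exact: measurable_funP. Qed.

(** Stationarity is a statement about probabilities of events, so the covariance is expressed by a
    joint probability before it is shifted. *)
Lemma gammaE i j : (gamma i j)%:E =
  (P ((Y i @^-1` cornerLe c1 p1) `&` (Y j @^-1` cornerLe c2 p2)) -
   (cornerF c1 p1 * cornerF c2 p2)%:E)%E.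
Proof.
set A := Y i @^-1` _; set B := Y j @^-1` _.
have [mA mB] : measurable A /\ measurable B by split; exact: mY.
have mAB : measurable (A `&` B) by exact: measurableI.
set F1 := cornerF c1 p1; set F2 := cornerF c2 p2.
have PA : mean P \1_A = F1 by rewrite mean_indic// probability_cornerLe.
have PB : mean P \1_B = F2 by rewrite mean_indic// probability_cornerLe.
have -> : gamma i j = mean P (fun w => \1_(A `&` B) w +
    (- F2 * \1_A w + (- F1 * \1_B w + F1 * F2))).
  have x1 w : xi c1 p1 (Y i w) = \1_A w - F1 by rewrite /xi !indicE.
  have x2 w : xi c2 p2 (Y j w) = \1_B w - F2 by rewrite /xi !indicE.
  by congr mean; apply/funext => w; rewrite x1 x2 indicI /=; ring.
have bA := bounded_mfun_indic (R := R) mA; have bB := bounded_mfun_indic (R := R) mB.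
have bc : bounded_mfun (fun _ : T => F1 * F2) by exact: bounded_mfun_cst.
have bB' := bounded_mfunD (bounded_mfunZ (- F1) bB) bc.
rewrite meanD; [|exact: bounded_mfun_indic|exact: bounded_mfunD (bounded_mfunZ _ bA) bB'].
rewrite (meanD P (bounded_mfunZ (- F2) bA) bB') (meanD P (bounded_mfunZ (- F1) bB) bc).
rewrite (meanZ P _ bA) (meanZ P _ bB) mean_cst PA PB mean_indic// -[in RHS](fineK (fin_num_measure P _ mAB)).
by rewrite -EFinB; congr EFin; ring.
Qed.

Lemma gamma_shift i j h : gamma (i + h) (j + h) = gamma i j.
Proof.
apply: EFin_inj; rewrite !gammaE; congr (_ - _)%E.
pose B : set (2.-tuple (d.-tuple R)) :=
  [set t | cornerLe c1 p1 (tnth t ord0) /\ cornerLe c2 p2 (tnth t ord_max)].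
have mB : measurable B.
  apply: measurableI; rewrite -[X in measurable X]setTI; exact: measurable_tnth.
pose idx (l : 'I_2) : int := if l == ord0 then i else j.
have E (f : 'I_2 -> int) : [set w | B [tuple Y (f l) w | l < 2]] =
    (Y (f ord0) @^-1` cornerLe c1 p1) `&` (Y (f ord_max) @^-1` cornerLe c2 p2).
  by apply/seteqP; split => w; rewrite /B /= !tnth_mktuple.
transitivity (P [set w | B [tuple Y (idx l + h) w | l < 2]]).
  by rewrite (E (fun l => idx l + h)).
by rewrite (statY idx h mB) E.
Qed.

Let measurable_obs_xi I c p i : unit_cube p -> I i ->
  measurable_fun (T := observed Y I) setT (fun w => xi c p (Y i w)).
Proof.
move=> pI Ii; apply: measurableT_comp; first exact: measurable_xi.
exact: measurable_observed.
Qed.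

Lemma gamma_cov i j :
  gamma i j = cov P (fun w => xi c1 p1 (Y i w)) (fun w => xi c2 p2 (Y j w)).
Proof. by rewrite /cov mean_xi// mul0r subr0. Qed.

Lemma gamma_le i r : (1 <= r)%N ->
  `|gamma i (i + r%:Z)| <= 4 * phi r /\ `|gamma (i + r%:Z) i| <= 4 * phi r.
Proof.
move=> r1; split; rewrite gamma_cov; last rewrite covC.
all: apply: (mixing_cov (k := i)) => //; try by [move=> w; exact: xi_le1].
all: by apply: measurable_obs_xi => /=.
Qed.

Lemma cov_lagE r : cov_lag Y (xi c1 p1) (xi c2 p2) r = (gamma 0 r)%:E.
Proof.
have [b1 b2] := (bounded_mfun_xi (Y 0) c1 p1I, bounded_mfun_xi (Y r) c2 p2I).
have e1 : ('E_P[xi c1 p1 \o Y 0] = 0)%E.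
  by rewrite -[LHS]/('E_P[fun w => xi c1 p1 (Y 0 w)])%E meanE// mean_xi.
have e2 : ('E_P[xi c2 p2 \o Y r] = 0)%E.
  by rewrite -[LHS]/('E_P[fun w => xi c2 p2 (Y r w)])%E meanE// mean_xi.
rewrite /cov_lag covariance.unlock e1 e2 /gamma -meanE; last exact: bounded_mfunM.
congr expectation; apply/funext => w.
by rewrite -[LHS]/((xi c1 p1 (Y 0 w) - 0) * (xi c2 p2 (Y r w) - 0)) !subr0.
Qed.

Lemma summable_cov_lag : summable [set: int] (cov_lag Y (xi c1 p1) (xi c2 p2)).
Proof.
have phi4 : (\esum_(n in [set: nat]) (4 * phi n.+1)%:E < +oo)%E.
  rewrite -nneseries_esumT; last by move=> n; rewrite lee_fin mulr_ge0.
  rewrite (@le_lt_trans _ _ (4 * Phi)%:E) ?ltry//.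
  apply: lime_le => //.
    by apply: is_cvg_nneseries => n _ _; rewrite lee_fin mulr_ge0.
  apply: nearW => N; rewrite sumEFin lee_fin big_mkord -mulr_sumr.
  by rewrite ler_wpM2l.
rewrite /summable esum_int//.
have pos n : (0 <= (4 * phi n.+1)%:E)%E by rewrite lee_fin mulr_ge0.
rewrite lte_add_pinfty//; last first.
  apply: le_lt_trans phi4; apply: le_esum => n _; rewrite cov_lagE lee_fin.
  have [_] := gamma_le (Negz n) (ltn0Sn n).
  by rewrite NegzE addNr.
(* Lag 0 is set apart, as the mixing bound starts at lag 1. *)
rewrite (esumID [set 0%N])//.
rewrite lte_add_pinfty//.
  rewrite (_ : _ `&` _ = [set 0%N]); last by apply/seteqP; split => // x [].
  by rewrite esum_set1// cov_lagE ltry.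
rewrite (_ : _ `&` _ = S @` [set: nat]); last first.
  apply/seteqP; split; last by move=> _ [n _ <-].
  by move=> [|n] [_ H]; [case: H|exists n].
rewrite esum_image//; last by move=> a b _ _ [].
apply: le_lt_trans phi4; apply: le_esum => n _; rewrite cov_lagE lee_fin.
by have [] := gamma_le 0 (ltn0Sn n); rewrite add0r.
Qed.

Lemma sum_int_cov_lag :
  gamma 0 0 + \sum_(r < N) (gamma 0 r.+1%:Z + gamma r.+1%:Z 0) @[N --> \oo] -->
  sum_int (cov_lag Y (xi c1 p1) (xi c2 p2)).
Proof.
have -> : (fun N => gamma 0 0 + \sum_(r < N) (gamma 0 r.+1%:Z + gamma r.+1%:Z 0)) =
    (fun N => \sum_(n < N.+1) fine (cov_lag Y (xi c1 p1) (xi c2 p2) n) +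
      \sum_(n < N) fine (cov_lag Y (xi c1 p1) (xi c2 p2) (Negz n))).
  apply/funext => N; rewrite big_ord_recl -addrA cov_lagE/= -big_split/=.
  congr (_ + _); apply: eq_bigr => r _; rewrite !cov_lagE/=; congr (_ + _).
  by rewrite -(gamma_shift 0 (Negz r) r.+1%:Z) add0r NegzE addNr.
exact: sum_int_cvg summable_cov_lag.
Qed.

End pairs.

(** Exchanging the two pairs changes r into - r, which preserves the symmetric partial sums. This is
    the symmetry of S. *)
Lemma sum_int_cov_lagC c1 c2 (p1 p2 : d.-tuple R) : unit_cube p1 -> unit_cube p2 ->
  sum_int (cov_lag Y (xi c1 p1) (xi c2 p2)) =
  sum_int (cov_lag Y (xi c2 p2) (xi c1 p1)).
Proof.
move=> p1I p2I; have H1 := @sum_int_cov_lag c1 c2 _ _ p1I p2I.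
have H2 := @sum_int_cov_lag c2 c1 _ _ p2I p1I.
have gC i j : gamma c2 c1 p2 p1 i j = gamma c1 c2 p1 p2 j i.
  by congr mean; apply/funext => w; rewrite mulrC.
apply: cvg_unique H1 _ => //=.
rewrite (_ : (fun N => _) = fun N => gamma c2 c1 p2 p1 0 0 +
    \sum_(r < N) (gamma c2 c1 p2 p1 0 r.+1%:Z + gamma c2 c1 p2 p1 r.+1%:Z 0))//.
apply/funext => N; rewrite gC; congr (_ + _); apply: eq_bigr => r _.
by rewrite !gC addrC.
Qed.

(** * Long-run variance and limit theorem for linear combinations *)

Section linear_combination.
Variables (m : nat) (c : 'I_m -> 'I_d -> bool) (p : 'I_m -> d.-tuple R).
Hypothesis pI : forall j, unit_cube (p j).
Variable u : 'rV[R]_m.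

Let x (k : nat) (w : T) : R := \sum_j u 0 j * xi (c j) (p j) (Y k%:Z w).

Let B : R := \sum_j `|u 0 j|.

Let B_ge0 : 0 <= B. Proof. exact: sumr_ge0. Qed.

Let g a b i j := gamma (c a) (c b) (p a) (p b) i j.

Let x_le k w : `|x k w| <= B.
Proof.
rewrite (le_trans (ler_norm_sum _ _ _))// ler_sum// => j _.
by rewrite normrM ler_piMr// xi_le1.
Qed.

Let measurable_x k : measurable_fun setT (x k).
Proof.
apply: measurable_sum => j; apply: measurable_funM => //.
exact: (bounded_mfun_xi (Y k) (c j) (pI j)).1.
Qed.

Let bounded_x k : bounded_mfun (x k).
Proof. exact: bounded_mfun_le (measurable_x k) (x_le k). Qed.

Let measurable_obs_x (I : set int) k : I k%:Z ->
  measurable_fun (T := observed Y I) setT (x k).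
Proof.
move=> Ik; apply: measurable_sum => j; apply: measurable_funM => //.
apply: measurableT_comp; first exact: measurable_xi.
exact: measurable_observed.
Qed.

Let mean_x k : mean P (x k) = 0.
Proof.
rewrite mean_sum; last by move=> j; apply: bounded_mfunZ; exact: bounded_mfun_xi.
rewrite big1// => j _; rewrite meanZ ?mean_xi ?mulr0//.
exact: bounded_mfun_xi.
Qed.

Let mean_xx i j : mean P (fun w => x i w * x j w) =
  \sum_a \sum_b u 0 a * u 0 b * g a b i j.
Proof.
have bxi k l := bounded_mfun_xi (Y k%:Z) (c l) (pI l).
rewrite -[LHS]/(mean P (fun w => (\sum_a u 0 a * xi (c a) (p a) (Y i w)) * x j w)).
under eq_fun do rewrite mulr_suml.
rewrite mean_sum; last by move=> a; apply: bounded_mfunM => //; exact: bounded_mfunZ.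
apply: eq_bigr => a _; under eq_fun do rewrite mulr_sumr.
rewrite mean_sum; last by move=> b; apply: bounded_mfunM; exact: bounded_mfunZ.
apply: eq_bigr => b _; rewrite -meanZ; last exact: bounded_mfunM.
by congr mean; apply/funext => w; ring.
Qed.

Let sum_norm_u : \sum_a \sum_b `|u 0 a * u 0 b| = B ^+ 2.
Proof.
rewrite expr2 mulr_suml; apply: eq_bigr => a _; rewrite mulr_sumr.
by apply: eq_bigr => b _; rewrite normrM.
Qed.

Let mean_xx_shift i r : mean P (fun w => x i w * x (i + r)%N w) =
  mean P (fun w => x 0 w * x r w).
Proof.
rewrite !mean_xx; apply: eq_bigr => a _; apply: eq_bigr => b _.
by rewrite /g -(gamma_shift _ _ (pI a) (pI b) 0 r i) add0r addrC PoszD.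
Qed.

Let G r := mean P (fun w => x 0 w * x r w).

Let G_le r : (1 <= r)%N -> `|G r| <= 4 * B ^+ 2 * phi r.
Proof.
move=> r1; rewrite /G mean_xx (le_trans (ler_norm_sum _ _ _))//.
rewrite [leRHS]mulrAC -sum_norm_u mulr_sumr ler_sum// => a _.
rewrite (le_trans (ler_norm_sum _ _ _))// mulr_sumr ler_sum// => b _.
rewrite normrM mulrC ler_wpM2r//.
by have [] := gamma_le (c a) (c b) (pI a) (pI b) 0 r1; rewrite add0r.
Qed.

(** The long-run variance truncated at lag N, which is also the increment of the block variance from
    length N to N + 1. *)
Let s N := G 0 + 2 * \sum_(r < N) G r.+1.

Let block_varS t p' : mean P (fun w => block x t p'.+1 w ^+ 2) =
  mean P (fun w => block x t p' w ^+ 2) + s p'.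
Proof.
have bb : bounded_mfun (block x t p') by exact: bounded_mfun_sum.
have bxb : bounded_mfun (fun w => \sum_(i < p') x (t + i) w * x (t + p')%N w).
  by apply: bounded_mfun_sum => i; exact: bounded_mfunM.
transitivity (mean P (fun w => block x t p' w ^+ 2 + (x (t + p')%N w * x (t + p' + 0)%N w +
    2 * \sum_(i < p') x (t + i) w * x (t + p')%N w))).
  congr mean; apply/funext => w; rewrite /block big_ord_recr/= addn0 -mulr_suml.
  by rewrite !expr2; ring.
rewrite meanD; [|exact: bounded_mfunX|]; last first.
  by apply: bounded_mfunD; [exact: bounded_mfunM|exact: bounded_mfunZ].
congr (_ + _); rewrite meanD; [|exact: bounded_mfunM|exact: bounded_mfunZ].
rewrite mean_xx_shift meanZ// mean_sum; last by move=> i; exact: bounded_mfunM.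
congr (_ + 2 * _); rewrite (reindex_inj rev_ord_inj)/=; apply: eq_bigr => i _.
rewrite /G -(mean_xx_shift (t + (p' - i.+1)) i.+1); congr mean; apply/funext => w.
by rewrite -addnA subnK.
Qed.

Let block_varE t n : mean P (fun w => block x t n w ^+ 2) = \sum_(l < n) s l.
Proof.
elim: n => [|n IH]; last by rewrite block_varS IH big_ord_recr.
rewrite big_ord0; under eq_fun do rewrite /block big_ord0 expr0n.
exact: mean_cst.
Qed.

Let v := (u *m longrun_cov Y c p *m u^T) 0 0.

Let s_cvg : s N @[N --> \oo] --> v.
Proof.
have gC a b i j : g a b i j = g b a j i.
  by congr mean; apply/funext => w; rewrite mulrC.
have sE N : s N = \sum_a \sum_b u 0 a * u 0 b *
    (g a b 0 0 + \sum_(r < N) (g a b 0 r.+1%:Z + g a b r.+1%:Z 0)).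
  have GE r : 2 * G r.+1 = \sum_a \sum_b u 0 a * u 0 b * (g a b 0 r.+1%:Z + g a b r.+1%:Z 0).
    have -> : 2 * G r.+1 = G r.+1 + mean P (fun w => x r.+1 w * x 0 w).
      rewrite mulr_natl mulr2n; congr (_ + _); congr mean.
      by apply/funext => w; rewrite mulrC.
    rewrite /G !mean_xx -big_split/=; apply: eq_bigr => a _.
    by rewrite -big_split/=; apply: eq_bigr => b _; rewrite mulrDr.
  rewrite /s mulr_sumr; under eq_bigr do rewrite GE.
  rewrite /G mean_xx [X in _ + X]exchange_big/= -big_split/=; apply: eq_bigr => a _.
  rewrite [X in _ + X]exchange_big/= -big_split/=; apply: eq_bigr => b _.
  by rewrite mulrDr mulr_sumr.
have -> : s = fun N => \sum_a \sum_b u 0 a * u 0 b *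
    (g a b 0 0 + \sum_(r < N) (g a b 0 r.+1%:Z + g a b r.+1%:Z 0)).
  exact/funext.
have -> : v = \sum_a \sum_b u 0 a * u 0 b *
    sum_int (cov_lag Y (xi (c a) (p a)) (xi (c b) (p b))).
  rewrite /v mxE exchange_big/=; apply: eq_bigr => b _.
  rewrite !mxE mulr_suml; apply: eq_bigr => a _.
  by rewrite !mxE; ring.
apply: cvg_big => [|a _]; [exact: add_continuous|].
apply: cvg_big => [|b _]; [exact: add_continuous|].
apply: cvgM; first exact: cvg_cst.
exact: sum_int_cov_lag.
Qed.

Let s_dist l N : (l <= N)%N ->
  `|s l - s N| <= 8 * B ^+ 2 * \sum_(r < N | (l <= r)%N) phi r.+1.
Proof.
move=> lN; rewrite -(subnK lN); set n := (N - l)%N.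
elim: n => [|n IH].
  rewrite add0n subrr normr0 mulr_ge0 ?sumr_ge0// mulr_ge0 ?sqr_ge0//.
rewrite addSn big_mkcond big_ord_recr -big_mkcond/= leq_addl mulrDr.
rewrite (_ : s l - s (n + l).+1 = s l - s (n + l)%N - 2 * G (n + l).+1); last first.
  by rewrite /s big_ord_recr/=; ring.
rewrite (le_trans (ler_normB _ _))// lerD// normrM ger0_norm//.
have := G_le (ltn0Sn (n + l)); lra.
Qed.

Let K := 8 * B ^+ 2 * Phi.

Let K_ge0 : 0 <= K. Proof. by rewrite !mulr_ge0 ?sqr_ge0. Qed.

(** The block variance is the sum of s l over l < n, and s l differs from s N by a sum of phi over
    lags beyond l. In the double sum phi (r + 1) occurs min (n, r + 1) times, whence the bound by
    Phi. The estimate holds for every N >= n and passes to the limit. *)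
Let block_var t n : `|mean P (fun w => block x t n w ^+ 2) - n%:R * v| <= K.
Proof.
rewrite block_varE.
have H N : (n <= N)%N -> `|\sum_(l < n) s l - n%:R * s N| <= K.
  move=> nN.
  rewrite (_ : _ - _ = \sum_(l < n) (s l - s N)); last first.
    by rewrite sumrB sumr_const card_ord mulr_natl.
  rewrite (le_trans (ler_norm_sum _ _ _))//.
  rewrite (@le_trans _ _ (\sum_(l < n) 8 * B ^+ 2 * \sum_(r < N | (l <= r)%N) phi r.+1))//.
    by apply: ler_sum => l _; apply: s_dist; rewrite ltnW// (leq_trans _ nN).
  rewrite -mulr_sumr ler_wpM2l ?mulr_ge0 ?sqr_ge0//.
  apply: le_trans (sum_rphi N.+1); rewrite big_ord_recl mul0r add0r.
  under eq_bigr do rewrite big_mkcond.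
  rewrite exchange_big/=; apply: ler_sum => r _.
  have cntE k : (\sum_(l < k) (l <= r) = minn k r.+1)%N.
    elim: k => [|k IHk]; first by rewrite big_ord0 min0n.
    rewrite big_ord_recr IHk/= /minn !ltnS.
    by case: (ltngtP k r) => kr; rewrite ?addn0 ?addn1 ?kr ?ltnn ?ltnW.
  rewrite (eq_bigr (fun l : 'I_n => (l <= r)%N%:R * phi r.+1)); last first.
    by move=> l _; case: (l <= r)%N; rewrite ?mul1r ?mul0r.
  by rewrite -mulr_suml -natr_sum cntE ler_wpM2r// ler_nat geq_minr.
have cv : `|\sum_(l < n) s l - n%:R * s N| @[N --> \oo] --> `|\sum_(l < n) s l - n%:R * v|.
  apply: cvg_norm; apply: cvgB; first exact: cvg_cst.
  by apply: cvgM => //; exact: cvg_cst.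
apply: (@ler_cvg_to nat \oo _ R _ (fun=> K) _ _ cv); first exact: cvg_cst.
near=> N; apply: H; near: N; exact: nbhs_infty_ge.
Unshelve. all: by end_near. Qed.

(** Otherwise n v + K, which bounds a second moment, would be negative for large n. *)
Let v_ge0 : 0 <= v.
Proof.
rewrite leNgt; apply/negP => v0.
have nv : 0 < - v by rewrite oppr_gt0.
have [N N0] := natr_large (K + 1) nv.
rewrite ler_pdivrMr ?ltr0n// => HN.
have := block_var 0 N; rewrite ler_norml => /andP[_].
have : 0 <= mean P (fun w => block x 0 N w ^+ 2).
  by apply: mean_ge0 => w; exact: sqr_ge0.
by move: HN; rewrite mulNr mulrC; lra.
Qed.

Let C := B ^+ 2 + K.

(** Holes in the selection only remove covariances, which are bounded in absolute value: each
    selected index adds at most B^2 for its square and 2 * 4 B^2 Phi = K for its products with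
    earlier ones. *)
Let selected_var (sel : pred nat) n :
  mean P (fun w => selected x sel n w ^+ 2) <= C * \sum_(i < n) (sel i)%:R.
Proof.
have bsel k : bounded_mfun (selected x sel k).
  rewrite /selected; under eq_fun do rewrite big_mkcond.
  by apply: bounded_mfun_sum => i; case: (sel i) => //; exact: bounded_mfun_cst.
elim: n => [|n IH].
  rewrite big_ord0 mulr0 /selected; under eq_fun do rewrite big_ord0 expr0n.
  by rewrite mean_cst.
have selS w : selected x sel n.+1 w = selected x sel n w + (if sel n then x n w else 0).
  by rewrite /selected big_mkcond big_ord_recr/= -big_mkcond.
rewrite big_ord_recr/= mulrDr; under eq_fun do rewrite selS.
case: (sel n); last by under eq_fun do rewrite addr0; rewrite mulr0 addr0.
have bsx : bounded_mfun (fun w => selected x sel n w * x n w) by exact: bounded_mfunM.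
have -> : mean P (fun w => (selected x sel n w + x n w) ^+ 2) =
    mean P (fun w => selected x sel n w ^+ 2) +
    (2 * mean P (fun w => selected x sel n w * x n w) + mean P (fun w => x n w ^+ 2)).
  rewrite -meanZ// -meanD; [|exact: bounded_mfunZ|exact: bounded_mfunX].
  rewrite -meanD; [|exact: bounded_mfunX|by apply: bounded_mfunD; [exact: bounded_mfunZ|exact: bounded_mfunX]].
  by congr mean; apply/funext => w; ring.
rewrite lerD// mulr1 /C addrC lerD//.
  rewrite (le_trans (ler_norm _))//; apply: norm_mean_le_cst => [|w]; first exact: bounded_mfunX.
  by rewrite normrX ler_sqr ?nnegrE.
suff : mean P (fun w => selected x sel n w * x n w) <= 4 * B ^+ 2 * Phi by rewrite /K; lra.
have mE : mean P (fun w => selected x sel n w * x n w) =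
    \sum_(i < n) (sel i)%:R * mean P (fun w => x i w * x n w).
  have -> : (fun w => selected x sel n w * x n w) =
      (fun w => \sum_(i < n) (sel i)%:R * (x i w * x n w)).
    apply/funext => w; rewrite /selected big_mkcond mulr_suml; apply: eq_bigr => i _.
    by case: (sel i); rewrite ?mul1r ?mul0r.
  rewrite mean_sum; last by move=> i; apply: bounded_mfunZ; exact: bounded_mfunM.
  by apply: eq_bigr => i _; rewrite meanZ//; exact: bounded_mfunM.
rewrite mE (@le_trans _ _ (\sum_(r < n) `|G r.+1|))//.
  rewrite [leRHS](reindex_inj rev_ord_inj)/=; apply: ler_sum => i _.
  have -> : mean P (fun w => x i w * x n w) = G (n - i.+1).+1.
    rewrite /G -(mean_xx_shift i); congr mean; apply/funext => w.
    by rewrite -subSn// subSS subnKC// ltnW.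
  by case: (sel i); rewrite ?mul1r ?mul0r// ler_norm.
apply: (@le_trans _ _ (\sum_(r < n) 4 * B ^+ 2 * phi r.+1)).
  by apply: ler_sum => r _; exact: G_le.
by rewrite -mulr_sumr ler_wpM2l// mulr_ge0// sqr_ge0.
Qed.

(** The past stops at t - 1, so the distance to the block is q + 1. Distance q is enough if q > 0;
    for q = 0, where the quotient would read 0, distance 1 is used. *)
Let mixing sel t q n a b l :
  `|cov P (fun w => cos (a + l * selected x sel t w))
          (fun w => cos (b + l * block x (t + q) n w))| <=
  (if q == 0%N then 4 * phi 1 else 8 * Phi / q%:R ^+ 2).
Proof.
have mf : measurable_fun (T := observed Y [set i | i <= t%:Z - 1]) setT
    (fun w => cos (a + l * selected x sel t w)).
  apply: (bounded_mfun_cos _).1; apply: measurable_funD => //; apply: measurable_funM => //.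
  have -> : selected x sel t = fun w => \sum_(i < t) (if sel i then x i w else 0).
    by apply/funext => w; rewrite /selected big_mkcond.
  apply: measurable_sum => i; case: (sel i) => //; apply: measurable_obs_x => /=.
  by rewrite lerBrDr -[1]/(1%:Z) -PoszD lez_nat addn1.
have mg (r : nat) : (r <= q.+1)%N ->
    measurable_fun (T := observed Y [set i | t%:Z - 1 + r%:Z <= i]) setT
    (fun w => cos (b + l * block x (t + q) n w)).
  move=> rq; apply: (bounded_mfun_cos _).1; apply: measurable_funD => //; apply: measurable_funM => //.
  apply: measurable_sum => i; apply: measurable_obs_x => /=.
  rewrite addrAC lerBlDr -[1]/(1%:Z) -!PoszD lez_nat -!addnA leq_add2l.
  by rewrite (leq_trans rq)// addn1 addnS ltnS leq_addr.
have cos1 (y : R) : `|cos y| <= 1 by exact: cos_max.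
case: eqP => [_|/eqP q0].
  by apply: mixing_cov mf (mg 1 _) _ _.
by apply: mixing_cov_sqr mf (mg q _) _ _; rewrite ?lt0n// leqnSn.
Qed.

Lemma linear_combination_variance_ge0 : 0 <= v. Proof. exact: v_ge0. Qed.

Lemma linear_combination_second_moment : exists C,
  forall n, mean P (fun w => block x 0 n w ^+ 2) <= C * n%:R.
Proof.
exists C => n.
by have := selected_var xpredT n; rewrite sumr_const card_ord.
Qed.

Lemma linear_combination_clt a :
  mean P (fun w => cos (a + (Num.sqrt n%:R)^-1 * block x 0 n w)) @[n --> \oo] -->
  cos a * expR (- (v / 2)).
Proof.
rewrite mulrC; apply: (block_clt measurable_x x_le mean_x v_ge0 K_ge0 _ block_var selected_var mixing (K2 := 8 * Phi)).
- by rewrite addr_ge0// sqr_ge0.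
- by rewrite mulr_ge0.
- by move=> q; case: q.
Qed.

End linear_combination.
End stationary_mixing.

(** Summability is asserted along with the limit because [sum_int] assigns a value even to families
    that are not summable. *)
Theorem theorem3p17 (R : realType) (disp : measure_display)
  (T : measurableType disp) (P : probability T R)
  (d : nat) (Y : int -> {RV P >-> d.-tuple R})
  (phi : nat -> R) (delta : R)
  (m : nat) (c : 'I_m -> 'I_d -> bool) (p : 'I_m -> d.-tuple R) :
  (1 <= d)%N ->
  strictly_stationary Y ->
  (forall i, uniform_on_cube (Y i)) ->
  (forall r, 0 <= phi r) ->
  (forall r, (1 <= r)%N -> (alpha_mixing Y r <= (phi r)%:E)%E) ->
  (\sum_(0 <= r <oo) (r%:R * phi r)%:E < +oo)%E ->
  0 < delta ->
  (\sum_(1 <= r <oo) (phi r `^ (delta / (2 + delta)))%:E < +oo)%E ->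
  (forall j, unit_cube (p j)) ->
  (forall a b, summable [set: int]
     (cov_lag Y (xi (c a) (p a)) (xi (c b) (p b)))) /\
  exists mu : probability (m.-tuple R) R,
    gaussian_law (longrun_cov Y c p) mu /\
    cvg_in_distribution P (normalized_sums Y c p) mu.
Proof.
move=> _ statY unifY phi0 alphaY sumphi _ _ pI.
split=> [a b|]; first by apply: (summable_cov_lag unifY phi0 alphaY sumphi); exact: pI.
have symS : (longrun_cov Y c p)^T = longrun_cov Y c p.
  by apply/matrixP => a b; rewrite !mxE; exact: (sum_int_cov_lagC statY unifY phi0 alphaY sumphi).
have [mu [gmu mu_cos]] := exists_gaussian symS
  (linear_combination_variance_ge0 statY unifY phi0 alphaY sumphi c pI).
exists mu; split=> //.
have dotE u n w : dot u (normalized_sums Y c p n w) = (Num.sqrt n%:R)^-1 *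
    block (fun k w => \sum_j u 0 j * xi (c j) (p j) (Y k%:Z w)) 0 n w.
  rewrite /dot /block; under eq_bigr do rewrite tnth_mktuple mulrCA mulr_sumr.
  by rewrite -mulr_sumr exchange_big.
have bdot u n : bounded_mfun (fun w => dot u (normalized_sums Y c p n w)).
  under eq_fun do rewrite dotE.
  apply: bounded_mfunZ; apply: bounded_mfun_sum => k; apply: bounded_mfun_sum => j.
  by apply: bounded_mfunZ; exact: bounded_mfun_xi.
have tnth_dot j n : (fun w => tnth (normalized_sums Y c p n w) j) =
    (fun w => dot (delta_mx 0 j) (normalized_sums Y c p n w)).
  by apply/funext => w; rewrite dot_delta.
have /choice[C HC] j : exists C, forall n,
    mean P (fun w => tnth (normalized_sums Y c p n w) j ^+ 2) <= C.
  have [C HC] := linear_combination_second_moment statY unifY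
    phi0 alphaY sumphi c pI (delta_mx 0 j).
  (* Needed at n = 0, where the normalizing factor is the inverse of 0, that is 0. *)
  have C0 : 0 <= C.
    have := HC 1%N; rewrite mulr1; apply: le_trans.
    by apply: mean_ge0 => w; exact: sqr_ge0.
  exists C => n; have -> : (fun w => tnth (normalized_sums Y c p n w) j ^+ 2) =
      (fun w => (Num.sqrt n%:R)^-1 ^+ 2 * block (fun k w => \sum_i
        (delta_mx 0 j : 'rV[R]_m) 0 i * xi (c i) (p i) (Y k%:Z w)) 0 n w ^+ 2).
    by apply/funext => w; rewrite -[tnth _ j]dot_delta dotE exprMn.
  rewrite meanZ; last first.
    apply: bounded_mfunX; apply: bounded_mfun_sum => k; apply: bounded_mfun_sum => i.
    by apply: bounded_mfunZ; exact: bounded_mfun_xi.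
  rewrite exprVn sqr_sqrtr//; have [->|n0] := posnP n; first by rewrite invr0 mul0r.
  by rewrite mulrC ler_pdivrMr ?ltr0n.
apply: (@weak_convergence _ _ _ _ _ _ _ (\sum_j C j)) => [n j|n|a u].
- by rewrite tnth_dot; exact: bdot.
- by apply: ler_sum => j _; exact: HC.
- rewrite mu_cos; suff -> : (fun n => mean P (fun w => cos (a + dot u (normalized_sums Y c p n w)))) =
    (fun n => mean P (fun w => cos (a + (Num.sqrt n%:R)^-1 * block (fun k w =>
       \sum_j u 0 j * xi (c j) (p j) (Y k%:Z w)) 0 n w))).
    exact: (linear_combination_clt statY unifY phi0 alphaY sumphi pI).
  by apply/funext => n; congr mean; apply/funext => w; rewrite dotE.
Qed.
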